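(* Let $d\in\mathbb{N}$, let $\boldsymbol{Y}$ be a tail process over $\mathbb{Z}^d$ with index $\alpha>0$ and such that its spectral tail process $\boldsymbol{\Theta}=\boldsymbol{Y}/|Y_{\boldsymbol{0}}|$ satisfies $\mathbb{P}(\boldsymbol{\Theta}\in l_0)=1$, and let $\vartheta=\mathbb{E}[|\mathrm{e}(\boldsymbol{Y})|^{-1}]$. Let $\boldsymbol{Q}=(Q_{\boldsymbol{i}})_{\boldsymbol{i}\in\mathbb{Z}^d}$ be any representative of its anchored spectral process. Then $$\mathbb{E}[h(\boldsymbol{\Theta})]=\vartheta\,\mathbb{E}\left[\sum_{\boldsymbol{k}\in\mathbb{Z}^d}h\left(\frac{\varphi_{\boldsymbol{k}}\boldsymbol{Q}}{|Q_{\boldsymbol{k}}|}\right)|Q_{\boldsymbol{k}}|^{\alpha}\right]$$ and $$\mathbb{E}\left[h(\varphi_A\boldsymbol{Q})\right]=\vartheta^{-1}\,\mathbb{E}\left[h\left(\frac{\varphi_A\boldsymbol{\Theta}}{\|\boldsymbol{\Theta}\|}\right)\cdot\frac{\|\boldsymbol{\Theta}\|^{\alpha}}{\sum_{\boldsymbol{k}\in\mathbb{Z}^d}|\Theta_{\boldsymbol{k}}|^{\alpha}}\right]$$ for all measurable $h:l_0\to[0,\infty)$, where $A=A^{fm}$ is the first maximum anchoring function. In the first formula the $\boldsymbol{k}$th summand on the right-hand side is understood to be zero if $|Q_{\boldsymbol{k}}|=0$.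
   Context: $\mathbb{R}^{\mathbb{Z}^d}$ carries the product $\sigma$-algebra; $|\boldsymbol{i}|=\max_k|i_k|$ for $\boldsymbol{i}\in\mathbb{Z}^d$. $l_0=\{\boldsymbol{x}\in\mathbb{R}^{\mathbb{Z}^d}:\lim_{|\boldsymbol{i}|\to\infty}|x_{\boldsymbol{i}}|=0\}$ with norm $\|\boldsymbol{x}\|=\sup_{\boldsymbol{i}}|x_{\boldsymbol{i}}|$. For $\boldsymbol{k}\in\mathbb{Z}^d$ the shift is $\varphi_{\boldsymbol{k}}\boldsymbol{x}=(x_{\boldsymbol{i}+\boldsymbol{k}})_{\boldsymbol{i}\in\mathbb{Z}^d}$. $\mathrm{e}(\boldsymbol{x})=\{\boldsymbol{k}:|x_{\boldsymbol{k}}|>1\}$, with cardinality $|\mathrm{e}(\boldsymbol{x})|$; $\mathcal{E}_0=\{\boldsymbol{x}\in\mathbb{R}^{\mathbb{Z}^d}:|x_{\boldsymbol{0}}|>1,|\mathrm{e}(\boldsymbol{x})|<\infty\}$. Tail process: $\boldsymbol{Y}=(Y_{\boldsymbol{i}})_{\boldsymbol{i}\in\mathbb{Z}^d}$ is the tail process of a (strictly) stationary real-valued random field $\boldsymbol{X}$ if $\mathbb{P}(|Y_{\boldsymbol{0}}|>1)=1$ and, for every $m\in\mathbb{N}$, the conditional distribution of $(u^{-1}X_{\boldsymbol{i}})_{\boldsymbol{i}\in\{-m,\dots,m\}^d}$ given $|X_{\boldsymbol{0}}|>u$ converges weakly, as $u\to\infty$, to the distribution of $(Y_{\boldsymbol{i}})_{\boldsymbol{i}\in\{-m,\dots,m\}^d}$.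 It is known that then $|Y_{\boldsymbol{0}}|$ is $\mathrm{Pareto}(\alpha)$-distributed ($\mathbb{P}(|Y_{\boldsymbol{0}}|>y)=y^{-\alpha}$, $y\ge1$) for some $\alpha>0$, called the (tail) index, and independent of the spectral tail process $\boldsymbol{\Theta}=\boldsymbol{Y}/|Y_{\boldsymbol{0}}|$. The condition $\mathbb{P}(\boldsymbol{\Theta}\in l_0)=1$ is equivalent to $\mathbb{P}(\boldsymbol{Y}\in\mathcal{E}_0)=1$. Anchoring function: a measurable map $A:\mathcal{E}_0\to\mathbb{Z}^d$ such that for all $\boldsymbol{x}\in\mathcal{E}_0$, $A(\boldsymbol{x})\in\mathrm{e}(\boldsymbol{x})$ and $A(\varphi_{\boldsymbol{k}}\boldsymbol{x})+\boldsymbol{k}=A(\boldsymbol{x})$ for all $\boldsymbol{k}\in\mathrm{e}(\boldsymbol{x})$. For such $A$, $\boldsymbol{Z}^A$ denotes a random element of $\mathcal{E}_0$ with distribution $\mathbb{P}(\boldsymbol{Y}\in\cdot\mid A(\boldsymbol{Y})=\boldsymbol{0})$ (the anchored process), and $\boldsymbol{Q}^A=\boldsymbol{Z}^A/\|\boldsymbol{Z}^A\|$. One has $\vartheta=\mathbb{P}(A(\boldsymbol{Y})=\boldsymbol{0})>0$ for every $A$. A function $h$ on $l_0$ is shift-invariant if $h(\varphi_{\boldsymbol{k}}\boldsymbol{x})=h(\boldsymbol{x})$ for all $\boldsymbol{x}\in l_0,\boldsymbol{k}\in\mathbb{Z}^d$. A random element $\boldsymbol{Q}$ of $l_0$ is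 a representative of the anchored spectral (tail) process of $\boldsymbol{Y}$ if $\mathbb{E}[h(\boldsymbol{Q})]=\mathbb{E}[h(\boldsymbol{Q}^A)]$ for all shift-invariant measurable $h:l_0\to[0,\infty)$, for some (equivalently, every) anchoring function $A$. First maximum anchoring function: $A^{fm}(\boldsymbol{x})=\min\{\boldsymbol{k}\in\mathbb{Z}^d:|x_{\boldsymbol{k}}|=\max_{\boldsymbol{i}}|x_{\boldsymbol{i}}|\}$, the minimum being with respect to an arbitrary fixed group order on $\mathbb{Z}^d$ (a translation invariant total order); this formula defines $A^{fm}$ on all of $l_0\setminus\{\boldsymbol{0}\}$. Write $\varphi_A\boldsymbol{x}:=\varphi_{A(\boldsymbol{x})}\boldsymbol{x}$. *)

(* Defs.v *)
From HB Require Import structures.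
From mathcomp Require Import all_boot all_order all_algebra.
From mathcomp Require Import all_classical all_reals all_analysis.

Set Implicit Arguments.
Unset Strict Implicit.
Unset Printing Implicit Defensive.

Import Order.TTheory GRing.Theory Num.Theory.
Import numFieldNormedType.Exports.

Local Open Scope classical_set_scope.
Local Open Scope ring_scope.

Definition znorm (d : nat) (i : 'rV[int]_d) : nat := \max_(k < d) `|i 0%R k|%N.

Definition cylinders (R : realType) (d : nat) : set (set ('rV[int]_d -> R)) :=
  \bigcup_(i in [set: 'rV[int]_d])
    preimage_set_system setT (fun x : 'rV[int]_d -> R => x i) measurable.

(* The space of real functions on the lattice Z^d, with its product
   sigma-algebra. *)
Definition rfield (R : realType) (d : nat) : Type :=
  g_sigma_algebraType (@cylinders R d).

Section fields.
Context {R : realType} {d : nat}.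
Implicit Types (x : rfield R d) (i k : 'rV[int]_d) (h : rfield R d -> R).

Definition shift_field k x : rfield R d := fun i => x (i + k).

(* The zero field if c = 0; in the uses below, c = 0 only on null events or in
   summands that are discarded. *)
Definition fdiv x (c : R) : rfield R d := fun i => x i / c.

(* Only meaningful for bounded x, as the elements of l0 and E0 are. *)
Definition supnorm x : R := sup [set `|x i| | i in [set: 'rV[int]_d]].

Definition l0 : set (rfield R d) :=
  [set x | forall e : R, 0 < e ->
    exists N : nat, forall i, (N < znorm i)%N -> `|x i| < e].

Definition exceed x : set 'rV[int]_d := [set k | 1 < `|x k|].

Definition E0 : set (rfield R d) :=
  [set x | 1 < `|x 0| /\ finite_set (exceed x)].

(* Z^d carries the discrete sigma-algebra; A is unconstrained outside E0. *)
Definition anchoring (A : rfield R d -> 'rV[int]_d) : Prop :=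
  [/\ forall B : set 'rV[int]_d, measurable (E0 `&` A @^-1` B),
      forall x, E0 x -> exceed x (A x)
    & forall x, E0 x -> forall k, exceed x k -> A (shift_field k x) + k = A x].

Definition shift_invariant h : Prop :=
  forall x k, l0 x -> h (shift_field k x) = h x.

(* h is a measurable map from l0 to [0, +oo[; its values outside l0 are
   irrelevant. *)
Definition nonneg_measurable_l0 h : Prop :=
  measurable_fun (l0 : set (rfield R d)) h /\ (forall x, l0 x -> 0 <= h x).

Definition group_order (le : rel 'rV[int]_d) : Prop :=
  [/\ reflexive le, antisymmetric le, transitive le, total le
    & forall i j k, le i j -> le (i + k) (j + k)].

Definition argmax x : set 'rV[int]_d := [set k | forall i, `|x i| <= `|x k|].

(* For nonzero x in l0 the set argmax x is finite and nonempty, so that the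
   least element below exists. *)
Definition first_max (le : rel 'rV[int]_d) x : 'rV[int]_d :=
  xget 0 [set k | argmax x k /\ forall j, argmax x j -> le k j].

Definition shift_first_max (le : rel 'rV[int]_d) x : rfield R d :=
  shift_field (first_max le x) x.

Definition spectral x : rfield R d := fdiv x `|x 0|.

Definition normalize x : rfield R d := fdiv x (supnorm x).

Definition box (m : nat) : Type := {i : 'rV[int]_d | (znorm i <= m)%N}.

Definition restrict_box (m : nat) x : {ptws box m -> R} := fun b => x (sval b).

End fields.

Arguments l0 {R d}.
Arguments E0 {R d}.
Arguments box : clear implicits.
Arguments restrict_box {R d} m x.

Section probability.
Context {R : realType} {d : nat}.
Local Open Scope ereal_scope.

(* E[h(V)] for a random field V almost surely (but possibly not everywhere) in
   the domain l0 of h. *)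
Definition expect_l0 (dT : measure_display) (T : measurableType dT)
    (P : probability T R) (V : T -> rfield R d) (h : rfield R d -> R) : \bar R :=
  \int[P]_(w in V @^-1` l0) (h (V w))%:E.

Definition stationary (dT : measure_display) (T : measurableType dT)
    (P : probability T R) (X : {RV P >-> rfield R d}) : Prop :=
  forall (k : 'rV[int]_d) (B : set (rfield R d)), measurable B ->
    P [set w | B (shift_field k (X w))] = P [set w | B (X w)].

(* Y is the tail process of X.  Weak convergence of the conditional laws on the
   finite-dimensional space R^{-m..m}^d is convergence of the conditional
   expectations of all bounded continuous functions. *)
Definition tail_process_of
    (dX : measure_display) (TX : measurableType dX) (PX : probability TX R)
    (X : {RV PX >-> rfield R d})
    (dT : measure_display) (T : measurableType dT) (P : probability T R)
    (Y : {RV P >-> rfield R d}) : Prop :=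
  [/\ stationary X,
      forall u : R, 0 < PX [set w | (u < `|X w 0%R|)%R],
      P [set w | (1 < `|Y w 0%R|)%R] = 1
    & forall (m : nat) (f : {ptws box d m -> R} -> R),
        continuous f -> (exists M : R, forall v, (`|f v| <= M)%R) ->
        (\int[PX]_(w in [set w | (u < `|X w 0%R|)%R])
            (f (restrict_box m (fdiv (X w) u)))%:E)
          / PX [set w | (u < `|X w 0%R|)%R] @[u --> +oo%R]
        --> \int[P]_w (f (restrict_box m (Y w)))%:E].

Definition tail_index (dT : measure_display) (T : measurableType dT)
    (P : probability T R) (Y : {RV P >-> rfield R d}) (alpha : R) : Prop :=
  (0 < alpha)%R /\
  forall y : R, (1 <= y)%R ->
    P [set w | (y < `|Y w 0%R|)%R] = (y `^ (- alpha))%:E.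

(* Z has the conditional law of Y given A(Y) = 0. *)
Definition anchored_process (dT : measure_display) (T : measurableType dT)
    (P : probability T R) (Y : {RV P >-> rfield R d})
    (A : rfield R d -> 'rV[int]_d)
    (dZ : measure_display) (TZ : measurableType dZ) (PZ : probability TZ R)
    (Z : {RV PZ >-> rfield R d}) : Prop :=
  (forall w, E0 (Z w)) /\
  forall B : set (rfield R d), measurable B ->
    PZ [set w | B (Z w)] =
    P [set w | [/\ B (Y w), E0 (Y w) & A (Y w) = 0%R]]
      / P [set w | E0 (Y w) /\ A (Y w) = 0%R].

Definition anchored_spectral_representative
    (dT : measure_display) (T : measurableType dT)
    (P : probability T R) (Y : {RV P >-> rfield R d})
    (dQ : measure_display) (TQ : measurableType dQ) (PQ : probability TQ R)
    (Q : {RV PQ >-> rfield R d}) : Prop :=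
  (forall w, l0 (Q w)) /\
  exists (A : rfield R d -> 'rV[int]_d)
         (dZ : measure_display) (TZ : measurableType dZ)
         (PZ : probability TZ R) (Z : {RV PZ >-> rfield R d}),
    [/\ anchoring A, anchored_process Y A Z
      & forall h : rfield R d -> R,
          nonneg_measurable_l0 h -> shift_invariant h ->
          expect_l0 PQ Q h = expect_l0 PZ (fun w => normalize (Z w)) h].

(* E[|e(Y)|^-1], with 1 / +oo = 0 *)
Definition vartheta (dT : measure_display) (T : measurableType dT)
    (P : probability T R) (Y : {RV P >-> rfield R d}) : \bar R :=
  \int[P]_w (counting (exceed (Y w)))^-1.

End probability.

(* Main.v *)
Require Import Defs.
From mathcomp Require Import all_boot all_order all_algebra.
From mathcomp Require Import finmap zify.
From mathcomp Require Import all_classical all_reals all_analysis.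
From mathcomp Require Import measurable_realfun.

Set Implicit Arguments.
Unset Strict Implicit.
Unset Printing Implicit Defensive.

Import Order.TTheory GRing.Theory Num.Theory.
Import numFieldNormedType.Exports.

Local Open Scope classical_set_scope.
Local Open Scope ring_scope.

(** Write [mu] for the law of Y, phi_k for the shift by k, e(x) for the set of
sites where |x| exceeds 1, and |x| also for the sup norm. Everything rests on
one identity, [change_of_origin]: for s >= 1, a site k and measurable B,

  mu {x : phi_(-k) x / s in B, |x_(-k)| > s}
    = s^(-alpha) mu {x in B : |x_k| > 1/s}.

It contains the stationarity of X (case s = 1) and the regular variation of
X_0 (case k = 0). To derive it, take test functions that vanish unless |x_0|
exceeds 1: for these the condition |X_0| > u in the definition of the tail
process is void, so that stationarity applies to plain expectations of X / u.
The ratio of P(|X_0| > s u) to P(|X_0| > u) is the same for all test functions;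
comparing two of them eliminates it, and the Pareto law identifies its limit.

Summed over k, the identity becomes a mass exchange, [exchange_formula]:

  int sum_(k : |x_k| > 1/s) G(phi_k x) mu(dx)
    = s^alpha int #e(x/s) G(x/s) mu(dx),

of which two cases are used.

For s = 1 and G carried by the event that the anchor is the origin, it gives
E[G(Y); A(Y) = 0] = E[G(Y) / #e(Y)] for shift-invariant G
([anchored_integral]), since each field has exactly one anchor. Taking G = 1
identifies vartheta with P(A(Y) = 0), and therefore every representative Q
satisfies, for every shift-invariant f ([representative_integral]),

  vartheta E[f(Q)] = E[f(Y / |Y|) / #e(Y)].

For large s it yields [spectral_formula]: for every h,

  E[h(Theta)] = E[|Y|^(-alpha) / #e(Y)
                    * sum_k h(phi_k Y / |Y_k|) |Y_k|^alpha].

Here the cut-off |x_k| > 1/s is harmless as long as h vanishes on fields of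
norm larger than s, because |x| >= |x_0| > 1; the exchange formula turns the
right-hand side into an integral where the radius |Y_0| can be integrated out,
by its independence of Theta ([radius_independent]); a monotone limit in s
treats general h.

The inner sum is shift-invariant and homogeneous of degree alpha in Y. Hence the
first formula is the combination of the last two displays. For the second
formula, the choice f(x) = h(phi_A x) in the first display has to be compared
with the choice h(phi_A theta / |theta|) |theta|^alpha / sum_k |theta_k|^alpha
of h in the second: there the sum over k cancels the denominator, which is
almost surely finite by the case h = 1. *)

(** * Countable sums of extended reals *)

Section countable_sums.
Context {R : realType} {I : countType}.
Local Open Scope ereal_scope.

(** Summing along the enumeration of a countable type reduces sums over the
lattice to series, for which measurability and Tonelli are available. *)
Lemma esum_nneseries (a : I -> \bar R) : (forall i, 0 <= a i) ->
  \esum_(i in [set: I]) a i = \sum_(n <oo) oapp a 0 (pickle_inv n).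
Proof.
move=> a0; set b := fun n => oapp a 0 (pickle_inv n).
have b0 n : 0 <= b n by rewrite /b; case: (pickle_inv n) => /=.
rewrite nneseries_esumT//.
transitivity (\esum_(n in range (@choice.pickle I)) b n).
  rewrite (esum_image _ (@choice.pickle I)); last first.
    by move=> x y _ _; exact: (pcan_inj choice.pickleK).
  by apply: eq_esum => i _; rewrite /b pickleK_inv.
rewrite esum_mkcond; apply: eq_esum => n _.
case: ifPn => // /negP nr; rewrite /b.
case E : (pickle_inv n) => [i|//]; case: nr; rewrite inE.
exists i => //; move: (@pickle_invK I n); by rewrite E.
Qed.

Context d (T : measurableType d).

Lemma measurable_esum (D : set T) (a : I -> T -> \bar R) :
  (forall i x, 0 <= a i x) -> (forall i, measurable_fun D (a i)) ->
  measurable_fun D (fun x => \esum_(i in [set: I]) a i x).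
Proof.
move=> a0 ma.
under eq_fun do rewrite esum_nneseries//.
apply: ge0_emeasurable_sum => n.
- by move=> x _ _; case: (pickle_inv n) => /=.
- by move=> _; case: (pickle_inv n) => [i|] /=; [exact: ma|exact: measurable_cst].
Qed.

Lemma integral_esum (mu : {measure set T -> \bar R}) (a : I -> T -> \bar R) :
  (forall i x, 0 <= a i x) -> (forall i, measurable_fun setT (a i)) ->
  \int[mu]_x (\esum_(i in [set: I]) a i x) =
  \esum_(i in [set: I]) \int[mu]_x a i x.
Proof.
move=> a0 ma.
under eq_integral do rewrite esum_nneseries//.
rewrite (integral_nneseries mu measurableT); last 2 first.
- by move=> n; case: (pickle_inv n) => [i|] /=; [exact: ma|exact: measurable_cst].
- by move=> n x _; case: (pickle_inv n) => [i|] /=.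
rewrite esum_nneseries; last by move=> i; apply: integral_ge0.
apply: eq_eseriesr => n _.
by case: (pickle_inv n) => [i|] //=; rewrite integral0.
Qed.

End countable_sums.

Section esum_extra.
Context {R : realType} {I : countType}.
Local Open Scope ereal_scope.

Lemma esumZl (c : R) (a : I -> \bar R) : (forall i, 0 <= a i) -> (0 <= c)%R ->
  \esum_(i in [set: I]) (c%:E * a i) = c%:E * \esum_(i in [set: I]) a i.
Proof.
move=> a0 c0.
rewrite !esum_nneseries//; last by move=> i; rewrite mule_ge0.
rewrite -nneseriesZl//; last by move=> n _; case: (pickle_inv n).
by apply: eq_eseriesr => n _; case: (pickle_inv n) => //=; rewrite mule0.
Qed.

Lemma esumMl (c : \bar R) (a : I -> \bar R) : (forall i, 0 <= a i) -> 0 <= c ->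
  \esum_(i in [set: I]) (c * a i) = c * \esum_(i in [set: I]) a i.
Proof.
move=> a0; case: c => [c|_|//]; first exact: esumZl.
have [az|/existsNP[i ai]] := pselect (forall i, a i = 0).
  by rewrite !esum1 ?mule0// => i _; rewrite az mule0.
have ai0 : 0 < a i by rewrite lt0e a0 andbT; exact/eqP.
have le_esum_at (b : I -> \bar R) : b i <= \esum_(j in [set: I]) b j.
  by apply: esum_ge; exists [set i]; [split|rewrite fsbig_set1].
rewrite (gt0_mulye (lt_le_trans ai0 (le_esum_at a))).
apply/eqP; rewrite -leye_eq; apply: le_trans (le_esum_at (fun j => +oo * a j)).
by rewrite gt0_mulye.
Qed.

(** Monotone convergence for sums: the suprema over finite sets of indices and
over [n] commute. *)
Lemma esum_cvg (a : nat -> I -> \bar R) (b : I -> \bar R) :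
  (forall n i, 0 <= a n i) -> (forall i, nondecreasing_seq (a ^~ i)) ->
  (forall i, a ^~ i @ \oo --> b i) ->
  (fun n => \esum_(i in [set: I]) a n i) @ \oo --> \esum_(i in [set: I]) b i.
Proof.
move=> a0 nda ab.
have nd : nondecreasing_seq (fun n => \esum_(i in [set: I]) a n i).
  by move=> m n mn; apply: le_esum => i _; exact: nda.
have le_ab n i : a n i <= b i.
  rewrite -(cvg_lim _ (ab i))//; apply: lime_ge; first by apply/cvg_ex; exists (b i); exact: ab.
  by near=> m; apply: nda; near: m; exists n.
suff -> : \esum_(i in [set: I]) b i =
    ereal_sup (range (fun n => \esum_(i in [set: I]) a n i)).
  exact: ereal_nondecreasing_cvgn.
apply/eqP; rewrite eq_le; apply/andP; split; last first.
  by apply: ge_ereal_sup => _ [n _ <-]; apply: le_esum => i _; exact: le_ab.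
apply: ge_ereal_sup => _ [A [finA _] <-].
have cA : (fun n => \sum_(i \in A) a n i) @ \oo --> \sum_(i \in A) b i.
  under eq_fun do rewrite fsbig_finite//.
  rewrite fsbig_finite//; apply: cvg_nnesum => // i _.
  exact: nearW.
rewrite -(cvg_lim _ cA)//; apply: lime_le; first by apply/cvg_ex; eexists; exact: cA.
apply: nearW => n; apply: (@le_trans _ _ (\esum_(i in [set: I]) a n i)).
  by apply: ereal_sup_ubound; exists A.
by apply: ereal_sup_ubound; exists n.
Unshelve. all: by end_near. Qed.

Lemma esum_pick {J : choiceType} (i0 : J) (a : J -> \bar R) : (forall i, 0 <= a i) ->
  \esum_(i in [set: J]) (if i == i0 then a i else 0) = a i0.
Proof.
move=> a0; rewrite -(esum_set1 (t := i0))// [RHS]esum_mkcond.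
by apply: eq_esum => i _; case: eqP => [->|ii0]; [rewrite mem_set|rewrite memNset].
Qed.

End esum_extra.

(** * The measurable space of random fields *)
Section measurability.
Context {R : realType} {d : nat}.
Local Notation Z := 'rV[int]_d.
Local Notation F := (rfield R d).

Lemma measurable_coord (i : Z) : measurable_fun setT (fun x : F => x i).
Proof.
move=> _ B mB; apply: sub_sigma_algebra.
by exists i => //; exists B.
Qed.

(** Coordinates generate the product sigma-algebra. *)
Lemma measurable_field {dT} {T : measurableType dT} (f : T -> F) :
  (forall i, measurable_fun setT (fun w => f w i)) -> measurable_fun setT f.
Proof.
move=> mf; apply: (@measurability _ _ T F setT f (@cylinders R d)) => //.
move=> _ [_ [i _ [B mB <-]] <-].
by rewrite !setTI; have := mf i measurableT B mB; rewrite setTI.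
Qed.

Lemma measurable_coord_comp {dT} {T : measurableType dT} (f : T -> F) i :
  measurable_fun setT f -> measurable_fun setT (fun w => f w i).
Proof. by move=> mf; apply: (measurableT_comp (measurable_coord i)). Qed.

Lemma measurable_shift (k : Z) : measurable_fun setT (@shift_field R d k).
Proof. by apply: measurable_field => i; exact: measurable_coord. Qed.

(** On nonnegative reals inversion is the power of exponent -1, also at 0. *)
Lemma measurable_funV_ge0 {dT} {T : measurableType dT} (D : set T) (g : T -> R) :
  (forall w, D w -> 0 <= g w) -> measurable_fun D g ->
  measurable_fun D (fun w => (g w)^-1).
Proof.
move=> g0 mg; apply: (eq_measurable_fun (fun w => g w `^ (-1))).
  by move=> w /[!inE] Dw; rewrite powR_inv1// g0.
by apply: (measurableT_comp (measurable_powR (-1))).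
Qed.

Lemma measurable_fdiv {dT} {T : measurableType dT} (f : T -> F) (g : T -> R) :
  (forall w, 0 <= g w) ->
  measurable_fun setT f -> measurable_fun setT g ->
  measurable_fun setT (fun w => fdiv (f w) (g w)).
Proof.
move=> g0 mf mg; apply: measurable_field => i; apply: measurable_funM.
  exact: measurable_coord_comp.
exact: measurable_funV_ge0.
Qed.

Lemma measurable_abs_coord (i : Z) : measurable_fun setT (fun x : F => `|x i|).
Proof. exact: (measurableT_comp (@normr_measurable R setT) (measurable_coord i)). Qed.

End measurability.

(** * Finite-dimensional regions and their continuous approximations *)
Section gauges.
Context {R : realType} {d : nat}.
Local Notation Z := 'rV[int]_d.
Local Notation F := (rfield R d).

(** A gauge is a continuous function of one coordinate. The sets where finitely
many gauges are positive form a pi-system that generates the product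
sigma-algebra, and their indicators are limits of bounded continuous functions
of finitely many coordinates. Since the limit is taken under the law of Y, after
the limit in the threshold, atoms of that law on boundaries do no harm. *)
Record gauge := Gauge
  { site : Z; level : R -> R; level_continuous : continuous level }.

Definition gauge_at (g : gauge) (x : F) : R := level g (x (site g)).

Definition region (L : seq gauge) : set F :=
  [set x | all (fun g => 0 < gauge_at g x) L].

Definition clamp (n : nat) (t : R) : R := Num.min 1 (Num.max 0 (n%:R * t)).

Definition soft_region (n : nat) (L : seq gauge) (x : F) : R :=
  \prod_(g <- L) clamp n (gauge_at g x).

Lemma clamp01 n t : 0 <= clamp n t <= 1.
Proof. by rewrite /clamp le_min ler01 ge_min lexx le_max lexx. Qed.

Lemma clamp_le0 n t : t <= 0 -> clamp n t = 0.
Proof.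
move=> t0; rewrite /clamp; have -> : Num.max 0 (n%:R * t) = 0.
  by apply/max_idPl; rewrite mulr_ge0_le0.
by apply/min_idPr; exact: ler01.
Qed.

Lemma continuous_clamp n : continuous (clamp n).
Proof.
move=> t; apply: (@continuous_min R R (cst 1) (fun t => Num.max 0 (n%:R * t))).
  exact: cvg_cst.
apply: (@continuous_max R R (cst 0) (fun t => n%:R * t)); first exact: cvg_cst.
exact: mulrl_continuous.
Qed.

Lemma cvg_clamp t : clamp n t @[n --> \oo] --> ((0 < t)%R%:R : R).
Proof.
have [t0|t0] := ltP 0 t; last first.
  by under eq_fun do rewrite clamp_le0//; exact: cvg_cst.
(* clamp n t = 1 as soon as n >= 1 / t *)
apply: cvg_near_cst.
near=> n; rewrite /clamp; apply/min_idPl; rewrite le_max; apply/orP; right.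
rewrite -ler_pdivrMr// div1r.
near: n; exact: nbhs_infty_ger.
Unshelve. all: by end_near. Qed.

Lemma soft_region01 n L x : 0 <= soft_region n L x <= 1.
Proof.
rewrite /soft_region; elim: L => [|g L /andP[IH0 IH1]];
  rewrite ?big_nil ?big_cons ?ler01 ?lexx//.
by have /andP[c0 c1] := clamp01 n (gauge_at g x); rewrite mulr_ge0// mulr_ile1.
Qed.

Lemma soft_region_eq0 n L g x : List.In g L -> gauge_at g x <= 0 -> soft_region n L x = 0.
Proof.
rewrite /soft_region; elim: L => // h L IH /= [-> g0|gL g0]; rewrite big_cons.
  by rewrite clamp_le0// mul0r.
by rewrite IH// mulr0.
Qed.

Lemma cvg_soft_region L x : soft_region n L x @[n --> \oo] --> (\1_(region L) x : R).
Proof.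
rewrite /soft_region; elim: L => [|g L IH].
  under eq_fun do rewrite big_nil.
  by rewrite indicE mem_set//; exact: cvg_cst.
under eq_fun do rewrite big_cons.
have -> : \1_(region (g :: L)) x = (0 < gauge_at g x)%R%:R * \1_(region L) x :> R.
  rewrite !indicE -natrM mulnb; congr ((nat_of_bool _)%:R).
  apply/idP/idP; rewrite !inE /region/= => /andP[a b]; first by rewrite a inE.
  by apply/andP; split => //; move: b; rewrite inE.
by apply: cvgM; [exact: cvg_clamp|exact: IH].
Qed.

Lemma measurable_gauge_at g : measurable_fun setT (gauge_at g).
Proof.
apply: (measurableT_comp (f := level g)); last exact: measurable_coord.
by apply: continuous_measurable_fun; exact: level_continuous.
Qed.

Lemma measurable_soft_region n L : measurable_fun setT (soft_region n L).
Proof.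
elim: L => [|g L IH].
  rewrite (_ : soft_region n [::] = cst 1); first exact: measurable_cst.
  by apply/funext => x; rewrite /soft_region big_nil.
rewrite (_ : soft_region n (g :: L) = fun x => clamp n (gauge_at g x) * soft_region n L x).
  apply: measurable_funM => //.
  apply: (measurableT_comp (f := clamp n)); last exact: measurable_gauge_at.
  by apply: continuous_measurable_fun; exact: continuous_clamp.
by apply/funext => x; rewrite /soft_region big_cons.
Qed.

Lemma region_cons g L : region (g :: L) = [set x | 0 < gauge_at g x] `&` region L.
Proof. by apply/seteqP; split=> x /=; [move/andP|move=> h; apply/andP]. Qed.

Lemma region_cat L1 L2 : region (L1 ++ L2) = region L1 `&` region L2.
Proof.
by apply/seteqP; split=> x; rewrite /region /= all_cat;
  [move/andP|move=> h; apply/andP].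
Qed.

Lemma measurable_region L : measurable (region L).
Proof.
elim: L => [|g L IH]; first by rewrite (_ : region [::] = setT)//; apply/seteqP.
rewrite region_cons; apply: measurableI => //.
rewrite -[X in measurable X]setTI.
have -> : [set x | 0 < gauge_at g x] = gauge_at g @^-1` `]0, +oo[.
  by apply/seteqP; split => x /=; rewrite in_itv/= andbT.
exact: measurable_gauge_at.
Qed.

Lemma gauge_above_cont (a : R) : continuous (fun t : R => t - a).
Proof. by move=> t; apply: cvgB; [exact: cvg_id|exact: cvg_cst]. Qed.

Lemma regions_generate : @measurable _ F = <<s range region >>.
Proof.
apply/seteqP; split; last first.
  apply: smallest_sub; first exact: sigma_algebra_measurable.
  by move=> _ [L _ <-]; exact: measurable_region.
apply: smallest_sub; first exact: smallest_sigma_algebra.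
move=> _ [i _ [B mB <-]].
pose GT := g_sigma_algebraType (range region).
suff mi : measurable_fun setT (fun x : GT => x i) by exact: mi.
apply: (measurability _ (RGenOInfty.measurableE R)) => _ [_ [a ->] <-].
apply: sub_sigma_algebra; exists [:: Gauge i (@gauge_above_cont a)] => //.
rewrite setTI; apply/seteqP; split => x; rewrite /region /gauge_at/= andbT in_itv/= andbT.
  by rewrite subr_gt0.
by rewrite subr_gt0.
Qed.

(** Regions are stable under intersection, by concatenation of lists of gauges,
so Dynkin's lemma applies. *)
Lemma measure_eq_regions (m1 m2 : {measure set F -> \bar R}) :
  (m1 setT < +oo)%E -> (forall L, m1 (region L) = m2 (region L)) ->
  forall B, measurable B -> m1 B = m2 B.
Proof.
move=> m1oo m12 B; apply: (@measure_unique _ R F (range region) (fun=> setT)) => //.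
- exact: regions_generate.
- move=> _ _ [L1 _ <-] [L2 _ <-]; exists (L1 ++ L2) => //; exact: region_cat.
- by move=> _; exists [::] => //; apply/seteqP.
- by rewrite bigcup_const.
- by move=> _ [L _ <-].
Qed.

Lemma integral_soft_region_cvg {dT} {T : measurableType dT} (P : probability T R)
    (V : T -> F) L : measurable_fun setT V ->
  (\int[P]_w (soft_region n L (V w))%:E @[n --> \oo] --> P (V @^-1` region L))%E.
Proof.
move=> mV.
have mVL : measurable (V @^-1` region L).
  by rewrite -[X in measurable X]setTI; apply: mV => //; exact: measurable_region.
have -> : P (V @^-1` region L) = (\int[P]_w (\1_(V @^-1` region L) w)%:E)%E.
  by rewrite integral_indic// setIT.
have := @dominated_convergence _ T R P setT measurableT
  (fun n w => (soft_region n L (V w))%:E) (fun w => (\1_(V @^-1` region L) w)%:E)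
  (cst 1%E).
case => //.
- move=> n; apply/measurable_EFinP.
  exact: (measurableT_comp (measurable_soft_region n L) mV).
- by apply/measurable_EFinP; exact: measurable_indic.
- apply: aeW => w _.
  have -> : \1_(V @^-1` region L) w = \1_(region L) (V w) :> R.
    by rewrite !indicE.
  by apply: cvg_EFin; [exact: nearW|exact: cvg_soft_region].
- exact: finite_measure_integrable_cst.
- apply: aeW => w n _; have /andP[b0 b1] := soft_region01 n L (V w).
  by rewrite /= ger0_norm// lee_fin.
Qed.

(** Extension by zero allows a function of the field that looks only at sites in
the box to be read as a function on the box. *)
Definition extend_box m (v : {ptws box d m -> R}) : F :=
  fun i => oapp v 0 (insub i).

Lemma extend_restrict m (x : F) i : (znorm i <= m)%N ->
  extend_box (restrict_box m x) i = x i.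
Proof. by move=> im; rewrite /extend_box insubT /=. Qed.

Lemma cvg_soft_region_at n L {U : Type} (G : set_system U) (V : U -> F) (x : F) :
  Filter G -> (forall i, V u i @[u --> G] --> x i) ->
  soft_region n L (V u) @[u --> G] --> soft_region n L x.
Proof.
move=> FG Vx; rewrite /soft_region; elim: L => [|g L IH].
  rewrite big_nil; under eq_cvg do rewrite big_nil.
  exact: cvg_cst.
rewrite big_cons; under eq_cvg do rewrite big_cons.
apply: cvgM => //.
have cg : {for x (site g), continuous (clamp n \o level g)}.
  apply: continuous_comp; first exact: level_continuous.
  exact: continuous_clamp.
exact: (@continuous_cvg U R R G FG (fun u => V u (site g)) _ _ cg (Vx _)).
Qed.

Lemma eq_soft_region n L x y : (forall g, List.In g L -> x (site g) = y (site g)) ->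
  soft_region n L x = soft_region n L y.
Proof.
rewrite /soft_region; elim: L => [|g L IH] xy; rewrite ?big_nil ?big_cons//.
rewrite IH; last by move=> h hL; apply: xy; right.
by rewrite /gauge_at xy//; left.
Qed.

(** The definition of the tail process speaks only about bounded continuous
functions on boxes; this makes [soft_region] one of them. *)
Lemma soft_region_finite_dim n L : exists m (f : {ptws box d m -> R} -> R),
  [/\ continuous f, exists M : R, forall v, `|f v| <= M
    & forall x, f (restrict_box m x) = soft_region n L x].
Proof.
pose m := (\max_(g <- L) znorm (site g))%N.
exists m, (fun v => soft_region n L (extend_box v)); split.
- move=> v; apply: (@cvg_soft_region_at n L _ (nbhs v) (@extend_box m) (extend_box v)).
  move=> i; rewrite /extend_box.
  case: insubP => [b _ _|_]; last exact: cvg_cst.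
  have := @proj_continuous _ (fun=> R) b v.
  exact.
- exists 1 => v; have /andP[b0 b1] := soft_region01 n L (extend_box v).
  by rewrite ger0_norm.
- move=> x; apply: eq_soft_region => g gL; apply: extend_restrict.
  by rewrite /m; elim: L gL {m} => // h L IH /= [->|/IH gL];
    rewrite big_cons leq_max ?leqnn// gL orbT.
Qed.

End gauges.

(** * Changing the origin and the scale of a tail process *)
Section laws.
Context {R : realType} {d : nat}.
Local Notation F := (rfield R d).
Local Open Scope ereal_scope.

Lemma eq_law_integral {dT} {T : measurableType dT}
    (m : {measure set T -> \bar R}) (V1 V2 : T -> F) (g : F -> \bar R) :
  measurable_fun setT V1 -> measurable_fun setT V2 ->
  (forall B, measurable B -> m (V1 @^-1` B) = m (V2 @^-1` B)) ->
  measurable_fun setT g -> (forall x, 0 <= g x) ->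
  \int[m]_w g (V1 w) = \int[m]_w g (V2 w).
Proof.
move=> mV1 mV2 eqV mg g0.
have H V : measurable_fun setT V -> \int[m]_w g (V w) = \int[pushforward m V]_x g x.
  by move=> mV; rewrite (ge0_integral_pushforward mV)// preimage_setT.
rewrite (H _ mV1) (H _ mV2).
by apply: eq_measure_integral => B mB _; exact: eqV.
Qed.

End laws.

Section moved_gauges.
Context {R : realType} {d : nat}.
Local Notation Z := 'rV[int]_d.
Local Notation F := (rfield R d).

(** Shift and scaling are handled together: the site [- k] becomes the origin, and
the value there is divided by [s]. *)
Definition rescale (s : R) (k : Z) (x : F) : F := fdiv (shift_field (- k) x) s.

Lemma measurable_rescale s k : (0 <= s)%R -> measurable_fun setT (rescale s k).
Proof.
move=> s0; apply: (measurable_fdiv (f := shift_field (- k)) (g := cst s)) => //.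
exact: measurable_shift.
Qed.

Lemma moved_continuous (s : R) (g : @gauge R d) :
  continuous (fun t : R => level g (t / s)).
Proof.
move=> t; apply: (@continuous_comp R R R (fun t : R => t / s) (level g) t).
  exact: mulrr_continuous.
exact: level_continuous.
Qed.

Definition move_gauge s k (g : @gauge R d) : gauge :=
  Gauge (site g - k) (@moved_continuous s g).

Lemma soft_region_move s k n L x :
  soft_region n (map (move_gauge s k) L) x = soft_region n L (rescale s k x).
Proof. by rewrite /soft_region big_map. Qed.

Lemma region_move s k L :
  region (map (move_gauge s k) L) = rescale s k @^-1` region L.
Proof. by apply/seteqP; split=> x; rewrite /region /= all_map. Qed.

End moved_gauges.

Section tail_limits.
Context {R : realType} {d : nat}.
Local Notation Z := 'rV[int]_d.
Local Notation F := (rfield R d).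
Variables (dX : measure_display) (TX : measurableType dX)
  (PX : probability TX R) (X : {RV PX >-> F})
  (dT : measure_display) (T : measurableType dT) (P : probability T R)
  (Y : {RV P >-> F}).
Hypothesis tailXY : tail_process_of X Y.

Let mX : measurable_fun setT X. Proof. exact: measurable_funPT. Qed.
Let mY : measurable_fun setT Y. Proof. exact: measurable_funPT. Qed.

Let level_set (u : R) : set TX := [set w | (u < `|X w 0%R|)%R].
Let p n L u : R := fine (\int[PX]_w (soft_region n L (fdiv (X w) u))%:E).
Let v u : R := fine (PX (level_set u)).
Let E n L : R := fine (\int[P]_w (soft_region n L (Y w))%:E).

Let m_level u : measurable (level_set u).
Proof.
rewrite -[X in measurable X]setTI.
have -> : level_set u = (fun w => `|X w 0%R|) @^-1` `]u, +oo[.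
  by apply/seteqP; split => w /=; rewrite in_itv/= andbT.
apply: (measurableT_comp (measurable_abs_coord 0) mX) => //.
Qed.

Lemma integral_soft_region_fin_num {d' : measure_display} {T' : measurableType d'}
    (P' : probability T' R) (V : T' -> F) n L : measurable_fun setT V ->
  (\int[P']_w (soft_region n L (V w))%:E)%E \is a fin_num.
Proof.
move=> mV; rewrite ge0_fin_numE; last first.
  by apply: integral_ge0 => w _; rewrite lee_fin; case/andP: (soft_region01 n L (V w)).
apply: (@le_lt_trans _ _ (\int[P']_w (cst 1%E) w)%E); last first.
  by rewrite integral_cst// mul1e (le_lt_trans (probability_le1 P' measurableT))// ltry.
apply: ge0_le_integral => //.
- by move=> w _; rewrite lee_fin; case/andP: (soft_region01 n L (V w)).
- by apply/measurable_EFinP; exact: (measurableT_comp (measurable_soft_region n L) mV).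
- by move=> w _; rewrite lee_fin; case/andP: (soft_region01 n L (V w)).
Qed.

Let v_gt0 u : 0 < v u.
Proof.
case: tailXY => _ /(_ u) V0 _ _; rewrite /v fine_gt0// V0/=.
by rewrite -ge0_fin_numE//; exact: fin_num_measure.
Qed.

(** For a function vanishing where |x_0| <= 1 the condition |X_0| > u is void, so
that the conditional expectation has an unconditional numerator, to which
stationarity applies. *)
Lemma tail_soft_region_cvg n L : (forall x : F, `|x 0| <= 1 -> soft_region n L x = 0) ->
  p n L u / v u @[u --> +oo] --> E n L.
Proof.
move=> L0; case: tailXY => _ _ _ lim.
have [m [f [cf bf fE]]] := soft_region_finite_dim n L.
have := lim m f cf bf.
under eq_integral do rewrite fE.
rewrite -(fineK (integral_soft_region_fin_num P n L mY)) => /fine_cvgP[_].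
apply: cvg_trans; apply: near_eq_cvg; near=> u.
have u0 : 0 < u by near: u; exact: nbhs_pinfty_gt.
have mfd : measurable_fun setT (fun w => fdiv (X w) u : F).
  by apply: measurable_fdiv => // _; exact: ltW.
have eqI : (\int[PX]_(w in level_set u) (f (restrict_box m (fdiv (X w) u)))%:E =
    \int[PX]_w (soft_region n L (fdiv (X w) u))%:E)%E.
  rewrite integral_mkcond; apply: eq_integral => w _.
  rewrite patchE fE; case: ifPn => // /negP wu; rewrite L0//.
  rewrite /fdiv normrM normfV (gtr0_norm u0) ler_pdivrMr// mul1r leNgt.
  by apply/negP => h; apply: wu; rewrite inE.
rewrite /= -/(level_set u) eqI.
have -> : PX (level_set u) = (v u)%:E by rewrite fineK// fin_num_measure.
rewrite -(fineK (integral_soft_region_fin_num PX n L mfd)).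
by rewrite inver (gt_eqF (v_gt0 u)).
Unshelve. all: by end_near. Qed.

(** The shift disappears by stationarity, and the division by [s] turns the
threshold [u] into [s * u]. *)
Lemma soft_region_move_stationary n L (s : R) k (u : R) : 0 < s -> 0 < u ->
  p n (map (move_gauge s k) L) u = p n L (s * u).
Proof.
move=> s0 u0; rewrite /p; congr fine.
case: tailXY => st _ _ _.
pose g (x : F) := (soft_region n L (fdiv x (s * u)))%:E.
transitivity (\int[PX]_w g (shift_field (- k) (X w)))%E.
  apply: eq_integral => w _; rewrite soft_region_move /g; congr (soft_region n L _)%:E.
  by apply/funext => i; rewrite /rescale /fdiv /shift_field invfM mulrCA mulrA mulrC mulrA.
apply: eq_law_integral => //.
- exact: (measurableT_comp (measurable_shift _) mX).
- by move=> B mB; exact: st.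
- apply/measurable_EFinP; apply: (measurableT_comp (measurable_soft_region n L)).
  by apply: measurable_fdiv => // _; rewrite mulr_ge0// ltW.
- by move=> x; rewrite lee_fin; case/andP: (soft_region01 n L (fdiv x (s * u))).
Qed.

Lemma scale_cvg (s : R) (f : R -> R) (l : R) : 0 < s ->
  f u @[u --> +oo] --> l -> f (s * u) @[u --> +oo] --> l.
Proof.
move=> s0 fl; apply: (@cvg_comp _ _ _ (fun u => s * u) f _ _ _ _ fl).
move=> A [M [Mr MA]]; exists (M / s); split; first exact: num_real.
by move=> u; rewrite ltr_pdivrMr// mulrC => /MA.
Qed.

(** By the previous lemma, the conditional expectation at level [u] of a moved
function is the one at level [s * u] of the original function, up to the factor
P(|X_0| > s u) / P(|X_0| > u). This factor is the same for [L] and [J], hence it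
disappears from the cross products, and no limit of it is needed. *)
Lemma tail_expectations_proportional n L J (s : R) k : 0 < s ->
  (forall x : F, `|x 0| <= 1 -> soft_region n L x = 0) ->
  (forall x : F, `|x 0| <= 1 -> soft_region n J x = 0) ->
  (forall x : F, `|x 0| <= 1 -> soft_region n (map (move_gauge s k) L) x = 0) ->
  (forall x : F, `|x 0| <= 1 -> soft_region n (map (move_gauge s 0) J) x = 0) ->
  E n (map (move_gauge s k) L) * E n J = E n (map (move_gauge s 0) J) * E n L.
Proof.
move=> s0 L0 J0 L'0 J'0.
have H1 := tail_soft_region_cvg L'0.
have H2 := scale_cvg s0 (tail_soft_region_cvg J0).
have H3 := tail_soft_region_cvg J'0.
have H4 := scale_cvg s0 (tail_soft_region_cvg L0).
have oF : ProperFilter (pinfty_nbhs R) by exact: proper_pinfty_nbhs.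
have C1 := cvgM (FF := oF) H1 H2.
have C2 := cvgM (FF := oF) H3 H4.
apply: (norm_cvg_unique C1).
move: C2; apply: cvg_trans; apply: near_eq_cvg; near=> u.
have u0 : 0 < u by near: u; exact: nbhs_pinfty_gt.
rewrite /= !soft_region_move_stationary//.
by rewrite mulrACA [RHS]mulrACA [p n J _ * p n L _]mulrC.
Unshelve. all: by end_near. Qed.


Lemma tail_regions_proportional L J (s : R) k : 0 < s ->
  (forall n (x : F), `|x 0| <= 1 -> soft_region n L x = 0) ->
  (forall n (x : F), `|x 0| <= 1 -> soft_region n J x = 0) ->
  (forall n (x : F), `|x 0| <= 1 -> soft_region n (map (move_gauge s k) L) x = 0) ->
  (forall n (x : F), `|x 0| <= 1 -> soft_region n (map (move_gauge s 0) J) x = 0) ->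
  (P (Y @^-1` region (map (move_gauge s k) L)) * P (Y @^-1` region J) =
   P (Y @^-1` region (map (move_gauge s 0) J)) * P (Y @^-1` region L))%E.
Proof.
move=> s0 L0 J0 L'0 J'0.
have mR K : measurable (Y @^-1` region K).
  by rewrite -[X in measurable X]setTI; apply: mY => //; exact: measurable_region.
have cE K : E n K @[n --> \oo] --> fine (P (Y @^-1` region K)).
  have := @integral_soft_region_cvg R d dT T P Y K mY.
  rewrite -{1}(fineK (fin_num_measure P _ (mR K))) => /fine_cvgP[_ h].
  exact: h.
have C1 := cvgM (FF := eventually_filter) (cE (map (move_gauge s k) L)) (cE J).
have C2 := cvgM (FF := eventually_filter) (cE (map (move_gauge s 0) J)) (cE L).
have eqE n : E n (map (move_gauge s k) L) * E n J =
             E n (map (move_gauge s 0) J) * E n L.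
  by apply: tail_expectations_proportional => //;
    [exact: L0|exact: J0|exact: L'0|exact: J'0].
have finP K : (P (Y @^-1` region K) = (fine (P (Y @^-1` region K)))%:E)%E.
  by rewrite fineK// fin_num_measure.
rewrite (finP L) (finP J) (finP (map _ L)) (finP (map _ J)) -!EFinM; congr (_%:E).
apply: (norm_cvg_unique C1); move: C2; apply: cvg_trans.
by apply: near_eq_cvg; apply: nearW => n /=; rewrite eqE.
Qed.

End tail_limits.

Lemma probability_setI1 {R : realType} {dT} {T : measurableType dT}
    (P : probability T R) (A D : set T) : measurable A -> measurable D ->
  P D = 1%E -> P (A `&` D) = P A.
Proof.
move=> mA mD D1.
have AD0 : P (A `\` D) = 0%E.
  apply/eqP; rewrite eq_le measure_ge0 andbT.
  have <- : P (~` D) = 0%E by rewrite probability_setC// D1 subee.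
  by apply: le_measure; rewrite ?inE; [exact: measurableD|exact: measurableC|].
by have /= := measureDI P mA mD; rewrite AD0 add0e => ->.
Qed.

Section tail_change_of_origin.
Context {R : realType} {d : nat}.
Local Notation Z := 'rV[int]_d.
Local Notation F := (rfield R d).

Lemma abs_gauge_continuous (s : R) : continuous (fun t : R => `|t| * s - 1).
Proof.
move=> t; apply: cvgB; last exact: cvg_cst.
apply: (@cvgM R R (nbhs t) _ (fun t => `|t|) (cst s)); last exact: cvg_cst.
exact: norm_continuous.
Qed.

Definition abs_gauge (k : Z) (s : R) : gauge := Gauge k (@abs_gauge_continuous s).

Variables (dX : measure_display) (TX : measurableType dX)
  (PX : probability TX R) (X : {RV PX >-> F})
  (dT : measure_display) (T : measurableType dT) (P : probability T R)
  (Y : {RV P >-> F}).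
Hypothesis tailXY : tail_process_of X Y.
Variable alpha : R.
Hypothesis indexY : tail_index Y alpha.

Lemma measurable_exceed (k : Z) (c : R) : measurable [set x : F | c < `|x k|].
Proof.
rewrite -[X in measurable X]setTI.
have -> : [set x : F | c < `|x k|] = (fun x => `|x k|) @^-1` `]c, +oo[.
  by apply/seteqP; split => w /=; rewrite in_itv/= andbT.
exact: measurable_abs_coord.
Qed.

Let mu := distribution P Y.

Lemma law_exceed0 : mu [set x | 1 < `|x 0|] = 1%E.
Proof. by case: tailXY. Qed.

Lemma law_exceed0I (A : set F) : measurable A ->
  mu (A `&` [set x | 1 < `|x 0|]) = mu A.
Proof.
move=> mA; have m1 := measurable_exceed 0 1.
exact: probability_setI1 law_exceed0.
Qed.

(** It is enough to treat regions. To the gauges of [B] one adds |x_0| > 1 and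
|x_k| > 1/s; after the move these read |x_(-k)| > s and |x_0| > 1, so functions
supported on either region vanish where |x_0| <= 1, as
[tail_regions_proportional] requires. The comparison with the region |x_0| > 1
supplies the constant P(|Y_0| > s) = s^(-alpha). *)
Lemma change_of_origin_set (s : R) (k : Z) (B : set F) : 1 <= s -> measurable B ->
  mu (rescale s k @^-1` B `&` [set x | s < `|x (- k)|]) =
  ((s `^ (- alpha))%:E * mu (B `&` [set x : F | (s^-1 < `|x k|)%R]))%E.
Proof.
move=> s1 mB; have s0 : 0 < s by exact: lt_le_trans s1.
have mr := @measurable_rescale R d s k (ltW s0).
have mD1 := measurable_exceed (- k) s.
have mD2 := measurable_exceed k s^-1.
pose m1 := pushforward (mrestr mu mD1) (rescale s k).
pose m2 := mscale (NngNum (powR_ge0 s (- alpha))) (mrestr mu mD2).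
suff : m1 B = m2 B by [].
have pow_s : mu [set x : F | (s < `|x 0|)%R] = (s `^ (- alpha))%:E.
  by case: indexY => _ /(_ s s1).
move: B mB; apply: measure_eq_regions.
  change (mu (rescale s k @^-1` setT `&` [set x : F | (s < `|x (- k)|)%R]) < +oo)%E.
  rewrite preimage_setT setTI.
  by rewrite (le_lt_trans (probability_le1 mu mD1))// ltry.
move=> L0.
pose L := [:: abs_gauge 0 1, abs_gauge k s & L0].
pose J := [:: abs_gauge 0 1].
have eqJ : region J = [set x | 1 < `|x 0|].
  by apply/seteqP; split=> x; rewrite /region /gauge_at/= andbT mulr1 subr_gt0.
have eqJ' : region (map (move_gauge s 0) J) = [set x | s < `|x 0|].
  apply/seteqP; split=> x; rewrite region_move eqJ /rescale/= /fdiv /shift_field oppr0 addr0;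
   by rewrite normrM normfV (gtr0_norm s0) ltr_pdivlMr// mul1r.
have eqL : region L = region L0 `&` [set x | s^-1 < `|x k|] `&` [set x | 1 < `|x 0|].
  apply/seteqP; split=> x; rewrite /region /gauge_at/= mulr1 !subr_gt0 -ltr_pdivrMr// div1r.
    by move=> /and3P[].
  by move=> [[? ?] ?]; apply/and3P.
have eqL' : region (map (move_gauge s k) L) =
    rescale s k @^-1` region L0 `&` [set x | s < `|x (- k)|] `&` [set x | 1 < `|x 0|].
  rewrite region_move eqL.
  by apply/seteqP; split=> x /=; rewrite /rescale /fdiv /shift_field subrr add0r !normrM
    normfV (gtr0_norm s0) !ltr_pdivlMr// mulVf ?gt_eqF// mul1r => -[[? ?] ?].
have L_0 n (x : F) : `|x 0| <= 1 -> soft_region n L x = 0.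
  move=> x0; apply: (@soft_region_eq0 _ _ n _ (abs_gauge 0 1)); first by left.
  by rewrite /gauge_at/= mulr1 subr_le0.
have J_0 n (x : F) : `|x 0| <= 1 -> soft_region n J x = 0.
  move=> x0; apply: (@soft_region_eq0 _ _ n _ (abs_gauge 0 1)); first by left.
  by rewrite /gauge_at/= mulr1 subr_le0.
have L'_0 n (x : F) : `|x 0| <= 1 -> soft_region n (map (move_gauge s k) L) x = 0.
  move=> x0; apply: (@soft_region_eq0 _ _ n _ (move_gauge s k (abs_gauge k s))).
    by right; left.
  rewrite /gauge_at/= subrr normrM normfV (gtr0_norm s0) mulfVK ?gt_eqF//.
  by rewrite subr_le0.
have J'_0 n (x : F) : `|x 0| <= 1 -> soft_region n (map (move_gauge s 0) J) x = 0.
  move=> x0; apply: (@soft_region_eq0 _ _ n _ (move_gauge s 0 (abs_gauge 0 1))).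
    by left.
  rewrite /gauge_at/= subrr normrM normfV (gtr0_norm s0) mulr1 subr_le0.
  by rewrite ler_pdivrMr// mul1r (le_trans x0).
have := tail_regions_proportional tailXY s0 L_0 J_0 L'_0 J'_0.
have Pmu A : P (Y @^-1` A) = mu A by [].
rewrite !Pmu eqJ eqJ' eqL eqL' law_exceed0 mule1 pow_s.
rewrite law_exceed0I; last first.
  apply: measurableI; last exact: measurable_exceed.
  by rewrite -[X in measurable X]setTI; apply: mr => //; exact: measurable_region.
rewrite law_exceed0I//.
by apply: measurableI; [exact: measurable_region|exact: measurable_exceed].
Qed.

End tail_change_of_origin.

(** * Fields vanishing at infinity *)
Section finite_sets.

(** Used for the order of the lattice and for the size of the coordinates. *)
Lemma finite_least {T : choiceType} (r : rel T) (S : set T) :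
  transitive r -> total r -> finite_set S -> S !=set0 ->
  exists m, S m /\ forall j, S j -> r m j.
Proof.
move=> rtr rtot /finite_fsetP[X ->] [i0 /= i0X].
suff : forall s : seq T, s != [::] -> exists m, m \in s /\ forall j, j \in s -> r m j.
  move=> /(_ (enum_fset X)) [|m [mX mj]]; last by exists m; split => //= j jX; apply: mj.
  have : i0 \in enum_fset X by [].
  by apply: contraTneq => ->.
elim=> // a [_ _|b s /(_ isT)[m [ms mj]] _].
  by exists a; split; rewrite ?inE// => j /[!inE] /eqP ->; have := rtot a a; rewrite orbb.
have [am|ma] := orP (rtot a m).
  exists a; split; first by rewrite inE eqxx.
  move=> j; rewrite inE => /orP[/eqP ->|js]; first by have := rtot a a; rewrite orbb.
  exact: rtr am (mj j js).
exists m; split; first by rewrite inE ms orbT.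
by move=> j; rewrite inE => /orP[/eqP ->//|]; exact: mj.
Qed.

Lemma counting_esum {R : realType} {T : choiceType} (S : set T) :
  counting S = (\esum_(k in [set: T]) (\1_S k)%:E)%E :> \bar R.
Proof.
transitivity (\esum_(k in S) (1%:E : \bar R))%E; last first.
  rewrite esum_mkcond; apply: eq_esum => k _; rewrite indicE.
  by case: ifPn => // /negbTE ->.
have card_sum (X : {fset T}) : (\sum_(k \in [set` X]) (1%:E : \bar R))%E = (#|` X|%:R)%:E :> \bar R.
  rewrite fsbig_finite ?finite_fset// set_fsetK sumEFin.
  by rewrite big_const_seq count_predT iter_addr addr0.
rewrite /counting; case: asboolP => [fS|nfS].
  rewrite esum_fset// -[in RHS](fset_setK fS).
  by rewrite card_sum.
apply/esym/eq_infty => r.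
have [X XS nX] := @infinite_set_fset _ S (Num.truncn r).+1 nfS.
apply: (@le_trans _ _ (#|` X|%:R)%:E).
  rewrite lee_fin; apply: (@le_trans _ _ (Num.truncn r).+1%:R); first exact/ltW/truncnS_gt.
  by rewrite ler_nat.
rewrite -card_sum; apply: ereal_sup_ubound; exists [set` X] => //.
Qed.

End finite_sets.

Section lattice.
Context {d : nat}.
Local Notation Z := 'rV[int]_d.

Lemma finite_znorm_ball (N : nat) : finite_set [set i : Z | (znorm i <= N)%N].
Proof.
pose f (u : 'rV['I_(2 * N).+1]_d) : Z := map_mx (fun j : 'I_(2 * N).+1 => (j%:Z - N%:Z)%R) u.
apply: (@sub_finite_set _ _ (f @` setT)); last exact/finite_image/finite_finset.
move=> i /= iN.
have iNk k : (`|i 0%R k| <= N)%N.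
  apply: leq_trans iN; rewrite /znorm; exact: leq_bigmax.
exists (\row_k inord (absz (i 0%R k + N%:Z)%R)) => //.
apply/rowP => k; rewrite !mxE.
have := iNk k; move: (i 0%R k) => z zN.
rewrite inordK; last by lia.
by lia.
Qed.

End lattice.

Section vanishing_fields.
Context {R : realType} {d : nat}.
Local Notation Z := 'rV[int]_d.
Local Notation F := (rfield R d).
Implicit Types (x : F) (i k : Z).

(** Finiteness of the sets of large coordinates is visibly invariant under shifts
and scalings. *)
Lemma l0P x : l0 x <-> forall e : R, 0 < e -> finite_set [set i | e <= `|x i|].
Proof.
split=> [xl0 e e0|fx e e0].
  have [N xN] := xl0 e e0.
  apply: sub_finite_set (finite_znorm_ball N) => i /= ei.
  by rewrite leqNgt; apply/negP => /xN; rewrite ltNge ei.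
have /finite_fsetP[X XE] := fx e e0.
exists (\max_(i <- enum_fset X) znorm i)%N => i Ni.
rewrite ltNge; apply/negP => ei.
have : [set` X] i by rewrite -XE.
move=> /= iX; move: Ni; rewrite ltnNge => /negP; apply.
exact: (leq_bigmax_seq (F := @znorm d)).
Qed.

Lemma l0_shift k x : l0 x -> l0 (shift_field k x).
Proof.
move=> /l0P xl0; apply/l0P => e e0.
apply: sub_finite_set (finite_image (fun i => i - k) (xl0 e e0)).
by move=> i /= ei; exists (i + k) => //; rewrite addrK.
Qed.

Lemma l0_fdiv x c : l0 x -> l0 (fdiv x c).
Proof.
move=> /l0P xl0; apply/l0P => e e0; have [->|c0] := eqVneq c 0.
  by apply: sub_finite_set (@finite_set0 _) => i /=; rewrite /fdiv invr0 mulr0 normr0 leNgt e0.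
have c0' : 0 < `|c| by rewrite normr_gt0.
apply: sub_finite_set (xl0 (e * `|c|) (mulr_gt0 e0 c0')) => i /=.
by rewrite /fdiv normrM normfV ler_pdivlMr.
Qed.

(** If x_i is nonzero, only finitely many coordinates are as large as x_i, and one
of these is maximal. *)
Lemma argmax_ex x : l0 x -> exists k, argmax x k.
Proof.
move=> /l0P xl0; have [x0|] := pselect (forall i, x i = 0).
  by exists 0 => i; rewrite !x0.
move=> /existsNP[i xi].
have [||||m [Sm mj]] := @finite_least _ (fun j j' => `|x j'| <= `|x j|) [set j | `|x i| <= `|x j|].
- by move=> a b c ab bc; exact: le_trans bc ab.
- by move=> a b; exact: le_total.
- by apply: xl0; rewrite normr_gt0; exact/eqP.
- by exists i => /=.
exists m => j; have [ij|ji] := leP `|x i| `|x j|; first exact: mj.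
exact: le_trans (ltW ji) Sm.
Qed.

Lemma supnormE x k : argmax x k -> supnorm x = `|x k|.
Proof.
move=> xk; apply/eqP; rewrite eq_le; apply/andP; split.
  apply: ge_sup; first by exists `|x k|, k.
  by move=> _ [i _ <-]; exact: xk.
apply: ub_le_sup; last by exists k.
by exists `|x k| => _ [i _ <-]; exact: xk.
Qed.

Lemma supnorm_ge x i : l0 x -> `|x i| <= supnorm x.
Proof. by move=> /argmax_ex[k xk]; rewrite (supnormE xk). Qed.

Lemma supnorm_ge0 x : 0 <= supnorm x.
Proof.
rewrite /supnorm; have [ub|nub] := pselect (has_ubound [set `|x i| | i in [set: Z]]).
  by apply: (@le_trans _ _ `|x 0|) => //; apply: ub_le_sup => //; exists 0.
by rewrite sup_out// => -[].
Qed.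

Lemma argmax_shift k x j : argmax (shift_field k x) j <-> argmax x (j + k).
Proof.
split=> xj i; last exact: xj.
by have := xj (i - k); rewrite /shift_field subrK.
Qed.

Lemma supnorm_shift k x : supnorm (shift_field k x) = supnorm x.
Proof.
rewrite /supnorm; congr sup; apply/seteqP; split=> _ [i _ <-].
  by exists (i + k).
by exists (i - k) => //; rewrite /shift_field subrK.
Qed.

Lemma argmax_fdiv x c j : 0 < c -> argmax (fdiv x c) j <-> argmax x j.
Proof.
move=> c0; have ci : 0 < `|c^-1| by rewrite normr_gt0 invr_eq0 gt_eqF.
by split=> xj i; have := xj i; rewrite /fdiv !normrM ler_pM2r.
Qed.

Lemma supnorm_fdiv x c : l0 x -> 0 < c -> supnorm (fdiv x c) = supnorm x / c.
Proof.
move=> /argmax_ex[k xk] c0; rewrite (supnormE xk).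
rewrite (supnormE ((argmax_fdiv x k c0).2 xk)).
by rewrite /fdiv normrM normfV (gtr0_norm c0).
Qed.

Lemma fdivfdiv x a b : fdiv (fdiv x a) b = fdiv x (a * b).
Proof. by apply/funext => i; rewrite /fdiv invfM mulrA. Qed.

Lemma fdiv1 x : fdiv x 1 = x.
Proof. by apply/funext => i; rewrite /fdiv divr1. Qed.

Lemma shift_fdiv k x c : shift_field k (fdiv x c) = fdiv (shift_field k x) c.
Proof. by []. Qed.

Lemma shift_fieldD k j x : shift_field k (shift_field j x) = shift_field (k + j) x.
Proof. by apply/funext => i; rewrite /shift_field addrA. Qed.

Lemma shift_field0 x : shift_field 0 x = x.
Proof. by apply/funext => i; rewrite /shift_field addr0. Qed.

Section first_maximum.
Variable le : rel Z.
Hypothesis ordle : group_order le.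

Let least x : set Z := [set k | argmax x k /\ forall j, argmax x j -> le k j].

(** The zero field is excluded because there all sites are maximal. *)
Lemma first_max_least x : l0 x -> x <> (fun=> 0) -> least x (first_max le x).
Proof.
case: ordle => lerefl leanti letr letot _ xl0 xn0.
apply: xgetPex; apply: finite_least => //; last exact: argmax_ex.
have [k xk] := argmax_ex xl0.
have xk0 : 0 < `|x k|.
  rewrite normr_gt0; apply/eqP => xk0; apply: xn0; apply/funext => i.
  by have := xk i; rewrite xk0 normr0 normr_le0 => /eqP.
have /l0P/(_ _ xk0) := xl0; apply: sub_finite_set => i /=; exact.
Qed.

Lemma least_unique x k j : least x k -> least x j -> k = j.
Proof.
case: ordle => lerefl leanti letr letot _ [xk kj] [xj jk].
by apply: leanti; rewrite kj// jk.
Qed.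

Lemma first_maxE x k : least x k -> first_max le x = k.
Proof. by move=> xk; apply: xget_unique => // y xy; exact: (least_unique xy xk). Qed.

Lemma first_max_shift k x : l0 x -> x <> (fun=> 0) ->
  first_max le (shift_field k x) = first_max le x - k.
Proof.
move=> xl0 xn0; have [xm mj] := first_max_least xl0 xn0.
case: ordle => _ _ _ _ leD.
apply: first_maxE; split; first by apply/argmax_shift; rewrite subrK.
by move=> j /argmax_shift/mj /(leD _ _ (- k)); rewrite addrK.
Qed.

Lemma first_max_fdiv x c : 0 < c -> first_max le (fdiv x c) = first_max le x.
Proof.
move=> c0; rewrite /first_max; congr xget; apply/seteqP.
by split=> k [xk kj]; split; try (apply/(argmax_fdiv _ _ c0); exact: xk);
  move=> j /(argmax_fdiv _ _ c0); exact: kj.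
Qed.

Lemma shift_first_max_shift k x : l0 x ->
  shift_first_max le (shift_field k x) = shift_first_max le x.
Proof.
move=> xl0; rewrite /shift_first_max.
have [->|xn0] := pselect (x = (fun=> 0)); first by [].
by rewrite first_max_shift// shift_fieldD subrK.
Qed.

Lemma shift_first_max_fdiv x c : 0 < c ->
  shift_first_max le (fdiv x c) = fdiv (shift_first_max le x) c.
Proof. by move=> c0; rewrite /shift_first_max first_max_fdiv. Qed.

End first_maximum.

End vanishing_fields.

(** * Measurability of the norm, of the first maximum and of exceedance counts *)
Section field_measurability.
Context {R : realType} {d : nat}.
Local Notation Z := 'rV[int]_d.
Local Notation F := (rfield R d).
Implicit Types (x : F) (k : Z).

Lemma measurable_bigcup_countType {dT} {T : measurableType dT} {I : countType}
    (A : I -> set T) : (forall i, measurable (A i)) -> measurable (\bigcup_i A i).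
Proof. by move=> mA; apply: countable_bigcupT_measurable. Qed.

Lemma measurable_bigcap_countType {dT} {T : measurableType dT} {I : countType}
    (A : I -> set T) : (forall i, measurable (A i)) -> measurable (\bigcap_i A i).
Proof.
move=> mA; rewrite -[X in measurable X]setCK setC_bigcap; apply: measurableC.
by apply: measurable_bigcup_countType => i; exact: measurableC.
Qed.

Lemma measurable_l0 : measurable (l0 : set F).
Proof.
have -> : (l0 : set F) = \bigcap_(n : nat) \bigcup_(N : nat) \bigcap_(i : Z)
    [set x : F | (N < znorm i)%N -> `|x i| < n.+1%:R^-1].
  apply/seteqP; split=> [x xl0 n _|x xall e e0].
    have n0 : 0 < n.+1%:R^-1 :> R by rewrite invr_gt0.
    by have [N xN] := xl0 _ n0; exists N => // i _; exact: xN.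
  have [n ne] : exists n : nat, n.+1%:R^-1 < e.
    exists (Num.truncn e^-1); rewrite invf_plt ?posrE//.
    exact: truncnS_gt.
  have [N _ xN] := xall n Logic.I; exists N => i Ni.
  by apply: lt_trans ne; exact: xN.
apply: bigcapT_measurable => n; apply: bigcupT_measurable => N.
apply: measurable_bigcap_countType => i.
case: (ltnP N (znorm i)) => Ni; last first.
  by rewrite (_ : mkset _ = setT)//; apply/seteqP; split.
rewrite (_ : mkset _ = (fun x : F => `|x i|) @^-1` `]-oo, n.+1%:R^-1[).
  by rewrite -[X in measurable X]setTI; apply: measurable_abs_coord.
by apply/seteqP; split=> x /=; rewrite in_itv/= => H; [exact: H|move=> _; exact: H].
Qed.

(** On l0 the norm is attained, so it exceeds [a] exactly if some coordinate
does. *)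
Lemma measurable_supnorm : measurable_fun (l0 : set F) supnorm.
Proof.
apply: (measurability _ (RGenOInfty.measurableE R)) => _ [_ [a ->] <-].
have -> : l0 `&` supnorm @^-1` `]a, +oo[ =
    l0 `&` \bigcup_i [set x : F | a < `|x i|].
  apply/seteqP; split=> x [xl0 /=].
    rewrite in_itv/= andbT; have [k xk] := argmax_ex xl0.
    by rewrite (supnormE xk) => ax; split => //; exists k.
  by move=> [i _ ax]; split => //=; rewrite in_itv/= andbT (lt_le_trans ax)// supnorm_ge.
apply: measurableI; first exact: measurable_l0.
by apply: measurable_bigcup_countType => i; exact: measurable_exceed.
Qed.

Lemma measurable_argmax (k : Z) : measurable [set x : F | argmax x k].
Proof.
have -> : [set x : F | argmax x k] = \bigcap_i [set x : F | `|x i| <= `|x k|].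
  by apply/seteqP; split => x xk i; [move=> _|]; exact: xk.
apply: measurable_bigcap_countType => i.
have -> : [set x : F | `|x i| <= `|x k|] = (fun x : F => `|x i| <= `|x k|) @^-1` [set true].
  by apply/seteqP; split => x /=.
rewrite -[X in measurable X]setTI.
by apply: measurable_fun_ler => //; exact: measurable_abs_coord.
Qed.

Section measurable_first_max.
Variable le : rel Z.
Hypothesis ordle : group_order le.

Let least (k : Z) : set F := [set x | argmax x k /\ forall j, argmax x j -> le k j].

Let measurable_least k : measurable (least k).
Proof.
have -> : least k = [set x : F | argmax x k] `&`
    \bigcap_j (if le k j then setT else ~` [set x : F | argmax x j]).
  apply/seteqP; split=> x [xk kj]; split=> // j.
    by move=> _; case: ifPn => // /negP nkj xj; apply: nkj; exact: kj.
  by have := kj j Logic.I; case: ifP.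
apply: measurableI; first exact: measurable_argmax.
apply: measurable_bigcap_countType => j; case: ifPn => // _.
by apply: measurableC; exact: measurable_argmax.
Qed.

Lemma measurable_first_max k : measurable [set x : F | first_max le x = k].
Proof.
(* without a least maximiser the value is 0 *)
have -> : [set x : F | first_max le x = k] =
    least k `|` (if k == 0 then ~` \bigcup_j least j else set0).
  apply/seteqP; split=> x /=.
    rewrite /first_max; case: xgetP => [m -> Pm <-|Pn <-]; first by left.
    by right; rewrite eqxx => -[j _ xj]; exact: (Pn j).
  move=> [xk|]; first exact: first_maxE.
  case: eqP => // -> Pn; apply: xgetPN => j xj; by apply: Pn; exists j.
apply: measurableU => //; case: ifP => // _.
by apply: measurableC; exact: measurable_bigcup_countType.
Qed.

Lemma measurable_shift_first_max :
  measurable_fun setT (shift_first_max le : F -> F).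
Proof.
move=> _ B mB; rewrite setTI.
have -> : shift_first_max le @^-1` B = \bigcup_k
    ([set x | first_max le x = k] `&` shift_field k @^-1` B).
  apply/seteqP; split=> x /=; first by move=> xB; exists (first_max le x).
  by move=> [k _ [<-]].
apply: measurable_bigcup_countType => k; apply: measurableI.
  exact: measurable_first_max.
by rewrite -[X in measurable X]setTI; apply: measurable_shift.
Qed.

End measurable_first_max.

Local Open Scope ereal_scope.

Definition above (c : R) (k : Z) (x : F) : \bar R :=
  (\1_[set y : F | (c < `|y k|)%R] x)%:E.

Definition count_above (x : F) : \bar R := \esum_(k in [set: Z]) above 1 k x.

(** Real inversion gives 0 both for an infinite count and for a zero count. *)
Definition inv_count (x : F) : \bar R := ((fine (count_above x))^-1)%:E.

Lemma aboveE c k x : above c k x = if (c < `|x k|)%R then 1 else 0.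
Proof.
rewrite /above indicE; case: ifPn => [h|/negP h].
  by rewrite mem_set.
by rewrite memNset.
Qed.

Lemma above_ge0 c k x : 0 <= above c k x.
Proof. by rewrite aboveE; case: ifP. Qed.

Lemma measurable_above c k : measurable_fun setT (above c k).
Proof.
apply/measurable_EFinP; apply: measurable_indic; exact: measurable_exceed.
Qed.

Lemma measurable_count_above : measurable_fun setT count_above.
Proof.
apply: measurable_esum => [k x|k]; first exact: above_ge0.
exact: measurable_above.
Qed.

Lemma count_above_ge0 x : 0 <= count_above x.
Proof. by apply: esum_ge0 => k _; exact: above_ge0. Qed.

Lemma inv_count_ge0 x : 0 <= inv_count x.
Proof. by rewrite lee_fin invr_ge0 fine_ge0// count_above_ge0. Qed.

Lemma measurable_inv_count : measurable_fun setT inv_count.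
Proof.
apply/measurable_EFinP; apply: measurable_funV_ge0 => [x _|].
  by rewrite fine_ge0// count_above_ge0.
apply: measurableT_comp => //; exact: measurable_count_above.
Qed.

Lemma counting_exceed x : counting (exceed x) = count_above x.
Proof.
by rewrite counting_esum; apply: eq_esum => k _; rewrite /above !indicE.
Qed.

Lemma count_above_fin x : finite_set (exceed x) -> count_above x \is a fin_num.
Proof. by move=> fx; rewrite -counting_exceed /counting asboolT. Qed.

Lemma count_above_ge1 x k : (1 < `|x k|)%R -> 1 <= count_above x.
Proof.
move=> xk; apply: esum_ge; exists [set k]; first by split.
by rewrite fsbig_set1 aboveE xk.
Qed.

Lemma finite_exceed_l0 x : l0 x -> finite_set (exceed x).
Proof.
move=> /l0P /(_ _ ltr01); apply: sub_finite_set => k; exact: ltW.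
Qed.

Lemma count_aboveK x k : finite_set (exceed x) -> (1 < `|x k|)%R ->
  count_above x * inv_count x = 1.
Proof.
move=> fx /count_above_ge1; rewrite /inv_count -(fineK (count_above_fin fx)) lee_fin => n1.
by rewrite -EFinM divff// gt_eqF// (lt_le_trans ltr01).
Qed.

Lemma esum_translate (k : Z) (a : Z -> \bar R) :
  \esum_(i in [set: Z]) a (i + k)%R = \esum_(i in [set: Z]) a i.
Proof.
have bij : set_bij [set: Z] [set: Z] (fun i : Z => i + k)%R.
  split => //.
  - by move=> i j _ _; exact: addIr.
  - by move=> i _; exists (i - k)%R => //; rewrite subrK.
by rewrite [RHS](reindex_esum _ _ _ _ bij).
Qed.

Lemma count_above_shift k x : count_above (shift_field k x) = count_above x.
Proof.
by rewrite /count_above -[RHS](esum_translate k); apply: eq_esum => i _; rewrite !aboveE.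
Qed.

Lemma inv_count_shift k x : inv_count (shift_field k x) = inv_count x.
Proof. by rewrite /inv_count count_above_shift. Qed.

Lemma above_fdiv (s : R) k x : (0 < s)%R -> above 1 k (fdiv x s) = above s k x.
Proof.
by move=> s0; rewrite !aboveE /fdiv normrM normfV (gtr0_norm s0) ltr_pdivlMr// mul1r.
Qed.

End field_measurability.

(** * The exchange formula *)
Section restricted_integrals.
Context {R : realType} {dT : measure_display} {T : measurableType dT}.
Local Open Scope ereal_scope.

Lemma integral_indicM (mu : {measure set T -> \bar R}) (D : set T)
    (f : T -> \bar R) :
  \int[mu]_x ((\1_D x)%:E * f x) = \int[mu]_(x in D) f x.
Proof.
rewrite [RHS]integral_mkcond; apply: eq_integral => x _.
by rewrite epatch_indic muleC.
Qed.

Lemma integral_mrestr (mu : {measure set T -> \bar R}) (D : set T)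
    (mD : measurable D) (f : T -> \bar R) :
  measurable_fun setT f -> (forall x, 0 <= f x) ->
  \int[mrestr mu mD]_x f x = \int[mu]_(x in D) f x.
Proof.
move=> mf f0; transitivity (\int[mrestr mu mD]_(x in D) f x).
  rewrite (@ge0_negligible_integral _ _ _ (mrestr mu mD) setT (~` D))//.
  - by rewrite setTD setCK.
  - exact: measurableC.
  - by change (mu (~` D `&` D) = 0); rewrite setICl measure0.
apply: eq_measure_integral => A mA AD.
by change (mu (A `&` D) = mu A); rewrite setIidl.
Qed.

End restricted_integrals.

Section tail_law.
Context {R : realType} {d : nat}.
Local Notation Z := 'rV[int]_d.
Local Notation F := (rfield R d).

(** All that is used of the law of a tail process: the tail index is positive, the
origin is an exceedance, the field vanishes at infinity, and origin and scale can
be changed. *)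
Definition tail_law (alpha : R) (mu : probability F R) : Prop :=
  [/\ 0 < alpha, mu [set x | 1 < `|x 0|] = 1%E, mu l0 = 1%E
    & forall (s : R) (k : Z) (B : set F), 1 <= s -> measurable B ->
      mu (rescale s k @^-1` B `&` [set x | s < `|x (- k)|]) =
      ((s `^ (- alpha))%:E * mu (B `&` [set x : F | (s^-1 < `|x k|)%R]))%E].

Variables (mu : probability F R) (alpha : R).
Hypothesis tail_mu : tail_law alpha mu.

Local Open Scope ereal_scope.

Lemma change_of_origin (s : R) (k : Z) (g : F -> \bar R) : (1 <= s)%R ->
  measurable_fun setT g -> (forall x, 0 <= g x) ->
  \int[mu]_x (above s (- k) x * g (rescale s k x)) =
  (s `^ (- alpha))%:E * \int[mu]_x (above s^-1 k x * g x).
Proof.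
move=> s1 mg g0.
have s0 : (0 < s)%R by exact: lt_le_trans s1.
have mr := @measurable_rescale R d s k (ltW s0).
have mD1 := @measurable_exceed R d (- k) s.
have mD2 := @measurable_exceed R d k s^-1.
rewrite !integral_indicM.
transitivity (\int[pushforward (mrestr mu mD1) (rescale s k)]_x g x).
  rewrite (ge0_integral_pushforward mr)// preimage_setT integral_mrestr//.
    exact: measurableT_comp.
  by move=> x; exact: g0.
transitivity (\int[mscale (NngNum (powR_ge0 s (- alpha))) (mrestr mu mD2)]_x g x).
  by apply: eq_measure_integral => B mB _; by case: tail_mu => _ _ _ mu_change; exact: mu_change.
by rewrite ge0_integral_mscale// integral_mrestr.
Qed.

(** Move the origin of the summand of index k to -k: then phi_k is undone, and the
sum only counts the sites where x / s exceeds 1. *)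
Lemma exchange_formula (s : R) (G : F -> \bar R) : (1 <= s)%R ->
  measurable_fun setT G -> (forall x, 0 <= G x) ->
  (s `^ (- alpha))%:E *
    \int[mu]_x (\esum_(k in [set: Z]) (above s^-1 k x * G (shift_field k x))) =
  \int[mu]_x (count_above (fdiv x s) * G (fdiv x s)).
Proof.
move=> s1 mG G0.
have s0 : (0 < s)%R by exact: lt_le_trans s1.
have mGs k : measurable_fun setT (fun x : F => G (shift_field k x)).
  by apply: measurableT_comp => //; exact: measurable_shift.
have mfd : measurable_fun setT (fun x : F => fdiv x s).
  by apply: (measurable_fdiv (f := id) (g := cst s)) => // x; exact: ltW.
rewrite integral_esum; last 2 first.
- by move=> k x; rewrite mule_ge0// above_ge0.
- by move=> k; apply: emeasurable_funM => //; exact: measurable_above.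
rewrite -esumZl ?powR_ge0//; last first.
  by move=> k; apply: integral_ge0 => x _; rewrite mule_ge0// above_ge0.
transitivity (\esum_(k in [set: Z])
    \int[mu]_x (above s (- k) x * G (shift_field k (rescale s k x)))).
  by apply: eq_esum => k _; rewrite -(change_of_origin k s1 (mGs k)).
transitivity (\esum_(k in [set: Z]) \int[mu]_x (above 1 k (fdiv x s) * G (fdiv x s))).
  have bij : set_bij [set: Z] [set: Z] (fun i : Z => - i)%R.
    split; [by []|by move=> i j _ _; exact: oppr_inj|].
    by move=> i _; exists (- i)%R => //; rewrite opprK.
  rewrite [RHS](reindex_esum _ _ _ _ bij); apply: eq_esum => k _.
  apply: eq_integral => x _; rewrite above_fdiv//; congr (_ * G _).
  by rewrite /rescale -shift_fdiv shift_fieldD subrr shift_field0.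
rewrite -integral_esum; last 2 first.
- by move=> k x; rewrite mule_ge0// above_ge0.
- move=> k; apply: emeasurable_funM; last exact: measurableT_comp.
  by apply: measurableT_comp => //; exact: measurable_above.
apply: eq_integral => x _; rewrite [RHS]muleC -esumMl//; last first.
  by move=> k; exact: above_ge0.
by apply: eq_esum => k _; rewrite muleC.
Qed.

Lemma tail_ae : {ae mu, forall x : F, l0 x /\ (1 < `|x 0%R|)%R}.
Proof.
case: tail_mu => _ mu_exceed0 mu_l0 _.
have mE := @measurable_exceed R d 0 1.
have ml := @measurable_l0 R d.
exists (~` (l0 `&` [set x : F | (1 < `|x 0%R|)%R])); split.
- by apply: measurableC; exact: measurableI.
- apply: etrans (probability_setC mu (measurableI _ _ ml mE)) _.
  by rewrite probability_setI1// mu_l0 subee.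
- by move=> x /= nfg [xl x0]; apply: nfg; split.
Qed.

Lemma eq_integral_tail_ae (Q : F -> Prop) (f g : F -> \bar R) :
  {ae mu, forall x, Q x} ->
  measurable_fun setT f -> measurable_fun setT g ->
  (forall x, 0 <= f x) -> (forall x, 0 <= g x) ->
  (forall x, l0 x -> (1 < `|x 0|)%R -> Q x -> f x = g x) ->
  \int[mu]_x f x = \int[mu]_x g x.
Proof.
move=> Qae mf mg f0 g0 fg.
apply: ge0_ae_eq_integral => //.
by apply: filterS2 Qae tail_ae => x Qx [xl x0] _; exact: fg.
Qed.

Lemma eq_integral_tail (f g : F -> \bar R) :
  measurable_fun setT f -> measurable_fun setT g ->
  (forall x, 0 <= f x) -> (forall x, 0 <= g x) ->
  (forall x, l0 x -> (1 < `|x 0|)%R -> f x = g x) ->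
  \int[mu]_x f x = \int[mu]_x g x.
Proof.
move=> mf mg f0 g0 fg; apply: (@eq_integral_tail_ae (fun=> True)) => //.
- by apply: aeW.
- by move=> x xl x0 _; exact: fg.
Qed.

End tail_law.

(** * Independence of the radius and the spectral field *)
Import HBNNSimple.

Section value_partition.
Context {R : realType} {dT : measure_display} {T : measurableType dT}.
Local Open Scope ereal_scope.

Lemma measurable_if_eq (phi : T -> R) (v : R) (f : T -> \bar R) :
  measurable_fun setT phi -> measurable_fun setT f ->
  measurable_fun setT (fun x => if v == phi x then f x else 0).
Proof.
move=> mphi mf; apply: measurable_fun_ifT => //.
by apply: measurable_fun_eqr.
Qed.

(** On each piece where [phi] is constant its value can be treated as a number. *)
Lemma integral_value_partition (mu : {measure set T -> \bar R}) (A : set R)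
    (phi : T -> R) (f : T -> \bar R) :
  finite_set A -> (forall x, A (phi x)) -> measurable_fun setT phi ->
  measurable_fun setT f -> (forall x, 0 <= f x) ->
  \int[mu]_x f x = \sum_(v \in A) \int[mu]_x (if v == phi x then f x else 0).
Proof.
move=> finA phiA mphi mf f0.
rewrite -ge0_integral_fsum//; last 2 first.
- by move=> v; exact: measurable_if_eq.
- by move=> v x _; case: ifP.
apply: eq_integral => x _.
rewrite (fsbigD1 (phi x))// eqxx fsbig1; first exact/esym/adde0.
by move=> v [_ /= vx]; case: eqP vx.
Qed.

End value_partition.

Section polar.
Context {R : realType} {d : nat}.
Local Notation Z := 'rV[int]_d.
Local Notation F := (rfield R d).
Variables (mu : probability F R) (alpha : R).
Hypothesis tail_mu : tail_law alpha mu.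
Local Open Scope ereal_scope.

Let alpha_gt0 : (0 < alpha)%R. Proof. by case: tail_mu. Qed.

Lemma measurable_radius : measurable_fun setT (fun x : F => (`|x 0%R| `^ alpha)%R).
Proof.
exact: (measurableT_comp (measurable_powR alpha) (measurable_abs_coord 0%R)).
Qed.

Lemma measurable_above_radius (b : F -> R) (K : F -> \bar R) :
  measurable_fun setT b -> measurable_fun setT K ->
  measurable_fun setT (fun x : F => if (1 < b x * `|x 0%R| `^ alpha)%R then K x else 0).
Proof.
move=> mb mK; apply: measurable_fun_ifT => //.
apply: measurable_fun_ltr => //; apply: measurable_funM => //.
exact: measurable_radius.
Qed.

(** Scaling at the origin, with [s] such that s^(-alpha) = v. Stated with the power
|x_0|^alpha, the result is linear in the threshold [v]. *)
Lemma radius_tail (v : R) (K : F -> \bar R) : (0 <= v <= 1)%R ->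
  measurable_fun setT K -> (forall x, 0 <= K x) ->
  (forall x (s : R), (0 < s)%R -> K (fdiv x s) = K x) ->
  \int[mu]_x (if (1 < v * `|x 0%R| `^ alpha)%R then K x else 0) = v%:E * \int[mu]_x K x.
Proof.
move=> /andP[]; rewrite le_eqVlt => /predU1P[<- _ mK K0 _|v0 v1 mK K0 Khom].
  rewrite mul0e integral0_eq// => x _.
  by rewrite mul0r ltr10.
pose s := (v `^ (- alpha^-1))%R.
have a0 : (alpha != 0)%R by rewrite gt_eqF.
have vs : (v = s `^ (- alpha))%R.
  by rewrite /s -powRrM mulrNN mulVf// powRr1 ?ltW//.
have s0 : (0 < s)%R by exact: powR_gt0.
have s1 : (1 <= s)%R.
  rewrite /s powRN invf_ge1 ?powR_gt0//.
  have -> : (1 = 1 `^ alpha^-1 :> R)%R by rewrite powR1.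
  by apply: ge0_ler_powR; rewrite ?nnegrE ?invr_ge0 ?ler01 ?v1 ?(ltW v0) ?(ltW alpha_gt0).
have := change_of_origin tail_mu 0%R s1 mK K0.
rewrite -vs => H.
transitivity (\int[mu]_x (above s (- 0)%R x * K (rescale s 0%R x))).
  apply: eq_integral => x _; rewrite aboveE oppr0.
  have -> : K (rescale s 0%R x) = K x.
    by rewrite /rescale oppr0 shift_field0 Khom.
  have -> : (1 < v * `|x 0| `^ alpha)%R = (s < `|x 0|)%R.
    rewrite vs powRN mulrC ltr_pdivlMr ?powR_gt0// mul1r.
    have sn := ltW s0; have an := ltW alpha_gt0.
    apply/idP/idP => [|sx]; last by apply: gt0_ltr_powR; rewrite ?nnegrE.
    by apply: contraTT; rewrite -!leNgt => xs; apply: ge0_ler_powR; rewrite ?nnegrE.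
  by case: ifP => _; rewrite ?mul1e ?mul0e.
rewrite H; congr (_ * _).
apply: (eq_integral_tail tail_mu) => //.
- by apply: emeasurable_funM => //; exact: measurable_above.
- by move=> x; rewrite mule_ge0// above_ge0.
- move=> x _ x0; rewrite aboveE (le_lt_trans _ x0) ?mul1e//.
  by rewrite invf_le1.
Qed.

(** The radius |x_0| has the tail v -> v of [radius_tail] also when the threshold
depends on the direction of the field, that is, radius and direction are
independent. The values of [b] are approximated by simple functions on the real
line; composing these with [b] preserves invariance under scaling. *)
Lemma radius_independent (b : F -> R) (K : F -> \bar R) :
  measurable_fun setT b -> (forall x, 0 <= b x <= 1)%R ->
  (forall x (s : R), (0 < s)%R -> b (fdiv x s) = b x) ->
  measurable_fun setT K -> (forall x, 0 <= K x) ->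
  (forall x (s : R), (0 < s)%R -> K (fdiv x s) = K x) ->
  \int[mu]_x (if (1 < b x * `|x 0%R| `^ alpha)%R then K x else 0) =
  \int[mu]_x ((b x)%:E * K x).
Proof.
move=> mb b01 bhom mK K0 Khom.
pose pos (r : R) : \bar R := (Num.max r 0)%:E.
have mpos : measurable_fun setT pos.
  by apply/measurable_EFinP; apply: measurable_maxr.
have pos0 r : setT r -> 0 <= pos r by move=> _; rewrite lee_fin le_max lexx orbT.
(* simple approximations of the identity on the nonnegative reals *)
pose e := nnsfun_approx measurableT mpos.
have nde x : nondecreasing_seq (fun n => e n (b x)).
  by move=> m n mn; have /lefP := nd_nnsfun_approx measurableT mpos mn; exact.
have b0 x : (0 <= b x)%R by case/andP: (b01 x).
have ecvg x : e n (b x) @[n --> \oo] --> b x.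
  have /fine_cvgP[_] := cvg_nnsfun_approx measurableT mpos pos0 (Logic.I : setT (b x)).
  by rewrite (max_idPl (b0 x)).
have e_le n x : (e n (b x) <= b x)%R.
  rewrite -[leRHS](cvg_lim _ (ecvg x))//.
  apply: nondecreasing_cvgn_le; first exact: nde.
  by apply/cvg_ex; exists (b x); exact: ecvg.
have e_ge0 n x : (0 <= e n (b x))%R by exact: fun_ge0.
have me n : measurable_fun setT (fun x => e n (b x)).
  by apply: (measurableT_comp (f := e n)) => //; exact: measurable_funPT.
pose f n x : \bar R := if (1 < e n (b x) * `|x 0%R| `^ alpha)%R then K x else 0.
have mf n : measurable_fun setT (f n) by exact: measurable_above_radius.
have f0 n x : 0 <= f n x by rewrite /f; case: ifP.
have radius_ge0 (x : F) : (0 <= `|x 0%R| `^ alpha)%R by exact: powR_ge0.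
have step n : \int[mu]_x f n x = \int[mu]_x ((e n (b x))%:E * K x).
  have eK0 x : 0 <= (e n (b x))%:E * K x by rewrite mule_ge0// lee_fin.
  have meK : measurable_fun setT (fun x => (e n (b x))%:E * K x).
    by apply: emeasurable_funM => //; exact/measurable_EFinP.
  have fin_e : finite_set (range (e n)) by exact: fimfunP.
  have ran x : range (e n) (e n (b x)) by exists (b x).
  rewrite (integral_value_partition mu fin_e ran)//.
  rewrite [RHS](integral_value_partition mu fin_e ran)//.
  apply: eq_fsbigr => v _.
  have [v01|v01] := boolP (0 <= v <= 1)%R; last first.
    (* such a value is not attained by e n at a point b x *)
    rewrite !integral0_eq// => x _; case: eqP => // ve; case/negP: v01.
      by rewrite ve e_ge0 (le_trans (e_le n x))//; case/andP: (b01 x).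
    by rewrite ve e_ge0 (le_trans (e_le n x))//; case/andP: (b01 x).
  pose g x : \bar R := if v == e n (b x) then K x else 0.
  have mg : measurable_fun setT g by exact: measurable_if_eq.
  have g0 x : 0 <= g x by rewrite /g; case: ifP.
  transitivity (\int[mu]_x (if (1 < v * `|x 0%R| `^ alpha)%R then g x else 0)).
    by apply: eq_integral => x _; rewrite /f /g; case: eqP => [->|_]//; case: ifP.
  rewrite radius_tail//; last by move=> x s s0; rewrite /g bhom// Khom.
  rewrite -ge0_integralZl//; last by case/andP: v01.
  by apply: eq_integral => x _; rewrite /g; case: eqP => [->//|_]; rewrite mule0.
have lim1 : \int[mu]_x f n x @[n --> \oo] -->
    \int[mu]_x (if (1 < b x * `|x 0%R| `^ alpha)%R then K x else 0).
  rewrite (_ : (fun x => _) = fun x => limn (f ^~ x)); last first.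
    apply/funext => x; apply/esym/cvg_lim => //.
    case: ifPn => bx.
      apply: cvg_near_cst; near=> n; rewrite /f ifT//.
      near: n; apply: cvgr_gt bx.
      by apply: cvgM; [exact: ecvg|exact: cvg_cst].
    rewrite (_ : f ^~ x = cst 0); first exact: cvg_cst.
    apply/funext => n; rewrite /f ifF//; apply/negbTE; move: bx; rewrite -!leNgt.
    by apply: le_trans; rewrite ler_wpM2r.
  apply: cvg_monotone_convergence => //.
  move=> x _ m n mn; rewrite /f; case: ifP => [h|_]; last by case: ifP.
  by rewrite ifT// (lt_le_trans h)// ler_wpM2r// nde.
have lim2 : \int[mu]_x ((e n (b x))%:E * K x) @[n --> \oo] -->
    \int[mu]_x ((b x)%:E * K x).
  rewrite (_ : (fun x => (b x)%:E * K x) =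
      fun x => limn (fun n => (e n (b x))%:E * K x)); last first.
    apply/funext => x; apply/esym/cvg_lim => //.
    (* the product 0 * +oo is not continuous, but here the sequence is constant *)
    have [bx0|bx0] := eqVneq (b x) 0%R.
      rewrite (_ : (fun n => _) = cst 0); first by rewrite bx0 mul0e; exact: cvg_cst.
      apply/funext => n; suff -> : e n (b x) = 0%R by rewrite mul0e.
      by apply/eqP; rewrite eq_le e_ge0 andbT -[leRHS]bx0.
    apply: cvgeM; last exact: cvg_cst.
      by rewrite /mule_def; case: (K x).
    by apply: cvg_EFin; [exact: nearW|exact: ecvg].
  apply: cvg_monotone_convergence => //.
  - move=> n; apply: emeasurable_funM => //; exact/measurable_EFinP.
  - by move=> n x _; rewrite mule_ge0// lee_fin.
  - by move=> x _ m n mn; rewrite lee_wpmul2r// lee_fin nde.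
have := cvg_unique _ lim1.
by apply => //; move: lim2; under eq_cvg do rewrite -step.
Unshelve. all: by end_near. Qed.

End polar.

(** * The spectral formula *)
Section spectral_fields.
Context {R : realType} {d : nat}.
Local Notation Z := 'rV[int]_d.
Local Notation F := (rfield R d).
Implicit Types (x : F) (k : Z).
Local Open Scope ereal_scope.

Lemma measurable_if_in {dT} {T : measurableType dT} (S : set T) (f : T -> \bar R) :
  measurable S -> measurable_fun setT f ->
  measurable_fun setT (fun w => if w \in S then f w else 0).
Proof.
move=> mS mf; rewrite (_ : (fun w => _) = f \_ S).
  apply/(measurable_restrictT _ _).1 => //; exact: measurable_funTS.
by apply/funext => w; rewrite patchE.
Qed.

Lemma one_powR (p : R) : (1 `^ p = 1 :> R)%R.
Proof. by rewrite powR1. Qed.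

Lemma powR_div (a b p : R) : (0 <= a)%R -> (0 < b)%R ->
  ((a / b) `^ p = a `^ p * b `^ (- p))%R.
Proof.
move=> a0 b0; rewrite powRM// ?invr_ge0 ?(ltW b0)//; congr (_ * _)%R.
by rewrite -[(b^-1)%R]powR_inv1 ?(ltW b0)// -powRrM mulN1r.
Qed.

Lemma measurable_spectral : measurable_fun setT (@spectral R d).
Proof.
change (measurable_fun setT (fun x : F => fdiv x `|x 0%R|)).
apply: measurable_fdiv => //.
exact: measurable_abs_coord.
Qed.

Lemma spectral_fdiv x (s : R) : (0 < s)%R -> spectral (fdiv x s) = spectral x.
Proof.
move=> s0; rewrite /spectral fdivfdiv; congr fdiv.
by rewrite /fdiv normrM normfV (gtr0_norm s0) mulrC divfK// gt_eqF.
Qed.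

Lemma spectral_l0 x : l0 x -> l0 (spectral x).
Proof. exact: l0_fdiv. Qed.

(** A version of the sup norm that is measurable on the whole space. *)
Definition norm_l0 x : R := if x \in l0 then supnorm x else 0%R.

Lemma norm_l0E x : l0 x -> norm_l0 x = supnorm x.
Proof. by move=> xl0; rewrite /norm_l0 mem_set. Qed.

Lemma norm_l0_ge0 x : (0 <= norm_l0 x)%R.
Proof. by rewrite /norm_l0; case: ifP => // _; exact: supnorm_ge0. Qed.

Lemma measurable_norm_l0 : measurable_fun setT norm_l0.
Proof.
rewrite (_ : norm_l0 = supnorm \_ l0); last by apply/funext => x; rewrite patchE.
apply/(measurable_restrictT _ _).1; first exact: measurable_l0.
exact: measurable_supnorm.
Qed.

Definition norm_ball (s : R) : set F := l0 `&` [set x | (norm_l0 x <= s)%R].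

Lemma measurable_norm_ball s : measurable (norm_ball s).
Proof.
apply: measurableI; first exact: measurable_l0.
rewrite -[X in measurable X]setTI.
have -> : [set x | (norm_l0 x <= s)%R] = norm_l0 @^-1` `]-oo, s].
  by apply/seteqP; split=> x /=; rewrite in_itv.
exact: measurable_norm_l0.
Qed.

Lemma count_above_inv x : l0 x ->
  count_above x * inv_count x = if (1 < supnorm x)%R then 1 else 0.
Proof.
move=> xl0; have [k xk] := argmax_ex xl0; rewrite (supnormE xk).
case: ltP => x1; first by apply: count_aboveK x1; exact: finite_exceed_l0.
rewrite /count_above esum1 ?mul0e// => i _.
by rewrite aboveE ltNge (le_trans (xk i) x1).
Qed.

End spectral_fields.

Section weights.
Context {R : realType} {d : nat}.
Local Notation Z := 'rV[int]_d.
Local Notation F := (rfield R d).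
Implicit Types (x : F) (k : Z).
Variables (mu : probability F R) (alpha : R).
Hypothesis tail_mu : tail_law alpha mu.
Local Open Scope ereal_scope.

Let alpha_gt0 : (0 < alpha)%R. Proof. by case: tail_mu. Qed.

(** The function equal to [h] on spectral fields and homogeneous of degree
[alpha]. *)
Definition weight (h : F -> \bar R) x : \bar R :=
  if x 0%R == 0%R then 0 else h (spectral x) * (`|x 0%R| `^ alpha)%:E.

Definition weight_sum (h : F -> \bar R) x : \bar R :=
  \esum_(k in [set: Z]) weight h (shift_field k x).

(** The shift-invariant factor under which the weights sum up to the law of the
spectral field. *)
Definition density x : \bar R := (norm_l0 x `^ (- alpha))%:E * inv_count x.

Lemma density_ge0 x : 0 <= density x.
Proof. by rewrite mule_ge0 ?inv_count_ge0// lee_fin powR_ge0. Qed.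

Lemma measurable_density : measurable_fun setT density.
Proof.
apply: emeasurable_funM; last exact: measurable_inv_count.
apply/measurable_EFinP.
by apply: (measurableT_comp (measurable_powR (- alpha))); exact: measurable_norm_l0.
Qed.

Lemma density_shift k x : l0 x -> density (shift_field k x) = density x.
Proof.
move=> xl0; rewrite /density inv_count_shift norm_l0E; last exact: l0_shift.
by rewrite supnorm_shift norm_l0E.
Qed.

Section integrand.
Variable h : F -> \bar R.
Hypothesis mh : measurable_fun setT h.
Hypothesis h0 : forall x, 0 <= h x.

Lemma weight_ge0 x : 0 <= weight h x.
Proof.
by rewrite /weight; case: ifP => // _; rewrite mule_ge0// lee_fin powR_ge0.
Qed.

Lemma measurable_weight : measurable_fun setT (weight h).
Proof.
apply: measurable_fun_ifT => //.
  by apply: measurable_fun_eqr => //; exact: measurable_coord.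
apply: emeasurable_funM.
  by apply: (measurableT_comp mh); exact: measurable_spectral.
by apply/measurable_EFinP; exact: measurable_radius.
Qed.

Lemma measurable_weight_sum :
  measurable_fun setT (weight_sum h).
Proof.
apply: measurable_esum => [k x|k]; first exact: weight_ge0.
by apply: (measurableT_comp measurable_weight); exact: measurable_shift.
Qed.

Lemma weight_sum_ge0 x : 0 <= weight_sum h x.
Proof. by apply: esum_ge0 => k _; exact: weight_ge0. Qed.

(** Let [G] be the product of density and weight. If |x_0| > 1, a nonzero weight at
site k forces s |x_k| >= |x| > 1, so the sum over all sites is the sum over
|x_k| > 1/s and the exchange formula applies. In the resulting integral the
count cancels against the density, up to the condition |x| > s, and the powers of
the norm combine to a function of the spectral field theta alone; the condition
says that |x_0| > s / |theta|, an event of conditional probability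
(|theta| / s)^alpha given theta. *)
Lemma spectral_formula_ball (s : R) : (1 <= s)%R ->
  (forall x, ~ norm_ball s x -> h x = 0) ->
  \int[mu]_x h (spectral x) =
  \int[mu]_x (density x * weight_sum h x).
Proof.
move=> s1 hs; have s0 : (0 < s)%R by exact: lt_le_trans s1.
have sa0 : (0 < s `^ (- alpha))%R by exact: powR_gt0.
pose G x := density x * weight h x.
have G0 x : 0 <= G x by rewrite mule_ge0 ?density_ge0 ?weight_ge0.
have mG : measurable_fun setT G.
  by apply: emeasurable_funM; [exact: measurable_density|exact: measurable_weight].
suff : (s `^ (- alpha))%:E * \int[mu]_x h (spectral x) = (s `^ (- alpha))%:E *
    \int[mu]_x (density x * weight_sum h x).
  move=> /(congr1 (fun y => (s `^ (- alpha))^-1%:E * y)).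
  by rewrite !muleA -!EFinM mulVf ?gt_eqF// !mul1e.
transitivity ((s `^ (- alpha))%:E * \int[mu]_x
    (\esum_(k in [set: Z]) (above s^-1 k x * G (shift_field k x)))); last first.
  congr (_ * _); apply: (eq_integral_tail tail_mu).
  - apply: measurable_esum => [k x|k]; first by rewrite mule_ge0// above_ge0.
    apply: emeasurable_funM; first exact: measurable_above.
    by apply: (measurableT_comp mG); exact: measurable_shift.
  - by apply: emeasurable_funM; [exact: measurable_density|exact: measurable_weight_sum].
  - by move=> x; apply: esum_ge0 => k _; rewrite mule_ge0// above_ge0.
  - by move=> x; rewrite mule_ge0 ?density_ge0 ?weight_sum_ge0.
  move=> x xl0 x0; rewrite -esumMl ?density_ge0//; last by move=> k; exact: weight_ge0.
  apply: eq_esum => k _; rewrite /G density_shift//.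
  have [->|wk] := eqVneq (weight h (shift_field k x)) 0; first by rewrite !mule0.
  suff -> : above s^-1 k x = 1 by rewrite mul1e.
  rewrite aboveE ifT//; move: wk; rewrite /weight /shift_field add0r.
  case: ifPn => [_|xk0 wk]; first by rewrite eqxx.
  have [spk|nspk] := pselect (norm_ball s (spectral (shift_field k x))); last first.
    by move: wk; rewrite hs// mul0e eqxx.
  have xk : (0 < `|x k|)%R by rewrite normr_gt0.
  case: spk => _ /=; rewrite norm_l0E; last by apply: spectral_l0; exact: l0_shift.
  rewrite /spectral /shift_field add0r supnorm_fdiv//; last exact: l0_shift.
  rewrite supnorm_shift ler_pdivrMr// => H.
  rewrite -[(s^-1)%R]mul1r ltr_pdivrMr// mulrC.
  by apply: lt_le_trans H; apply: lt_le_trans x0 _; exact: supnorm_ge.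
rewrite (exchange_formula tail_mu)//.
(* the minimum only matters outside the ball, where K vanishes *)
pose b x := Num.min 1%R ((norm_l0 (spectral x) / s) `^ alpha)%R.
pose K x := (norm_l0 (spectral x) `^ (- alpha))%:E * h (spectral x).
have msp : measurable_fun setT (fun x => norm_l0 (spectral x)).
  by apply: (measurableT_comp measurable_norm_l0); exact: measurable_spectral.
have mhs : measurable_fun setT (fun x => h (spectral x)).
  by apply: (measurableT_comp mh); exact: measurable_spectral.
have mK : measurable_fun setT K.
  apply: emeasurable_funM => //; apply/measurable_EFinP.
  exact: (measurableT_comp (measurable_powR (- alpha))).
have K0 x : 0 <= K x by rewrite mule_ge0// lee_fin powR_ge0.
have mb : measurable_fun setT b.
  apply: measurable_minr => //.
  apply: (measurableT_comp (measurable_powR alpha)).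
  exact: measurable_funM.
have bE x : l0 x -> (1 < `|x 0%R|)%R -> norm_ball s (spectral x) ->
    b x = ((supnorm x / `|x 0%R| / s) `^ alpha)%R.
  move=> xl0 x0 [_ /=]; rewrite /b norm_l0E; last exact: spectral_l0.
  rewrite supnorm_fdiv ?(lt_trans _ x0)// => ts; apply/min_idPr.
  rewrite -[leRHS](one_powR alpha) ge0_ler_powR ?nnegrE ?(ltW alpha_gt0)//.
  - by rewrite !divr_ge0 ?supnorm_ge0 ?(ltW s0).
  - by rewrite ler_pdivrMr// mul1r.
have b01 x : (0 <= b x <= 1)%R.
  by rewrite /b le_min ler01 powR_ge0 ge_min lexx.
have bh x c : (0 < c)%R -> b (fdiv x c) = b x by move=> c0; rewrite /b spectral_fdiv.
have Kh x c : (0 < c)%R -> K (fdiv x c) = K x by move=> c0; rewrite /K spectral_fdiv.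
transitivity (\int[mu]_x ((b x)%:E * K x)).
  rewrite -ge0_integralZl//; last by rewrite lee_fin ltW.
  apply: (eq_integral_tail tail_mu).
  - exact: measurable_funeM.
  - by apply: emeasurable_funM => //; exact/measurable_EFinP.
  - by move=> x; rewrite mule_ge0// lee_fin ltW.
  - by move=> x; rewrite mule_ge0// lee_fin; case/andP: (b01 x).
  move=> x xl0 x0.
  have [spk|nspk] := pselect (norm_ball s (spectral x)); last first.
    by rewrite /K hs// !mule0.
  have x00 : (0 < `|x 0%R|)%R by exact: lt_trans x0.
  have M0 : (0 < supnorm x)%R by rewrite (lt_le_trans x00)// supnorm_ge.
  rewrite /K muleA; congr (_ * _); rewrite bE// norm_l0E; last exact: spectral_l0.
  rewrite supnorm_fdiv// -EFinM; congr EFin.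
  rewrite (powR_div _ (ltW (divr_gt0 M0 x00)) s0) mulrAC -powRD.
    by rewrite subrr powRr0 mul1r.
  by rewrite (gt_eqF (divr_gt0 M0 x00)) implybT.
rewrite -(radius_independent tail_mu)//.
apply: (eq_integral_tail tail_mu).
- exact: measurable_above_radius.
- have mfd : measurable_fun setT (fun x : F => fdiv x s).
    by apply: (measurable_fdiv (f := id) (g := cst s)) => // x; exact: ltW.
  apply: emeasurable_funM; last exact: (measurableT_comp mG mfd).
  exact: (measurableT_comp measurable_count_above mfd).
- by move=> x; case: ifP.
- by move=> x; rewrite mule_ge0// count_above_ge0.
move=> x xl0 x0.
have x00 : (0 < `|x 0%R|)%R by exact: lt_trans x0.
have M0 : (0 < supnorm x)%R by rewrite (lt_le_trans x00)// supnorm_ge.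
have sn := ltW s0; have xn := ltW x00; have Mn := ltW M0; have an := ltW alpha_gt0.
have xs0 : (fdiv x s 0%R == 0%R) = false.
  by apply/negbTE; rewrite /fdiv mulf_neq0 ?invr_eq0 ?(gt_eqF s0)// -normr_gt0.
rewrite /G /weight spectral_fdiv// xs0.
have [spk|nspk] := pselect (norm_ball s (spectral x)); last first.
  by rewrite /K hs// mul0e !mule0; case: ifP.
rewrite /density !muleA [count_above _ * _]muleC -(muleA _ (count_above _)).
rewrite count_above_inv; last exact: l0_fdiv.
rewrite supnorm_fdiv// bE// -powRM ?divr_ge0//.
have -> : (supnorm x / `|x 0| / s * `|x 0| = supnorm x / s)%R.
  by rewrite mulrAC divfK// gt_eqF.
have -> : (1 < (supnorm x / s) `^ alpha)%R = (1 < supnorm x / s)%R.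
  apply/idP/idP => [|h1].
    apply: contraTT; rewrite -!leNgt => h1; rewrite -[leRHS](one_powR alpha).
    by apply: ge0_ler_powR; rewrite ?nnegrE ?divr_ge0.
  rewrite -[ltLHS](one_powR alpha).
  by apply: gt0_ltr_powR; rewrite ?nnegrE ?divr_ge0.
case: ifP => _; last by rewrite mule0 !mul0e.
rewrite mule1 /K norm_l0E; last exact: spectral_l0.
rewrite norm_l0E; last exact: l0_fdiv.
rewrite supnorm_fdiv// supnorm_fdiv// muleAC; congr (_ * _); rewrite -EFinM.
congr EFin; rewrite /fdiv normrM normfV (gtr0_norm s0) !powR_div// !opprK.
rewrite mulrACA [(s `^ _ * _)%R]mulrC -powRD; last by rewrite (gt_eqF s0) implybT.
by rewrite addNr powRr0 mulr1.
Qed.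

End integrand.

End weights.

Section spectral_formula.
Context {R : realType} {d : nat}.
Local Notation Z := 'rV[int]_d.
Local Notation F := (rfield R d).
Implicit Types (x : F) (k : Z).
Variables (mu : probability F R) (alpha : R).
Hypothesis tail_mu : tail_law alpha mu.
Local Open Scope ereal_scope.

(** The balls exhaust l0, and both sides are continuous along increasing limits
of [h]. *)
Lemma spectral_formula (h : F -> \bar R) :
  measurable_fun setT h -> (forall x, 0 <= h x) ->
  \int[mu]_x h (spectral x) =
  \int[mu]_x (density alpha x * weight_sum alpha h x).
Proof.
move=> mh h0.
pose g x : \bar R := if x \in l0 then h x else 0.
have mg : measurable_fun setT g.
  by apply: measurable_if_in => //; exact: measurable_l0.
have g0 x : 0 <= g x by rewrite /g; case: ifP.
pose gn (n : nat) x : \bar R := if x \in norm_ball n.+1%:R then h x else 0.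
have mgn n : measurable_fun setT (gn n).
  by apply: measurable_if_in => //; exact: measurable_norm_ball.
have gn0 n x : 0 <= gn n x by rewrite /gn; case: ifP.
have gn_nd x : nondecreasing_seq (gn ^~ x).
  move=> m n mn; rewrite /gn; case: ifPn => [|_]; last by case: ifP.
  rewrite inE => -[xl0 xm]; rewrite ifT// inE; split => //=.
  by rewrite (le_trans xm)// ler_nat.
have gnE x : \forall n \near \oo, gn n x = g x.
  rewrite /gn /g; have [xl0|xl0] := boolP (x \in l0); last first.
    apply: nearW => n; rewrite ifF//; apply/negbTE; apply: contraNN xl0.
    by rewrite !inE => -[].
  near=> n; rewrite ifT// inE; split; first by rewrite -inE.
  rewrite /= (@le_trans _ _ n%:R)//; last by rewrite ler_nat.
  by near: n; exact: nbhs_infty_ger.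
have dens0 := @density_ge0 R d alpha.
have md := @measurable_density R d alpha.
have mws f mf f0 := @measurable_weight_sum R d alpha f mf f0.
have ws0 f f0 := @weight_sum_ge0 R d alpha f f0.
have msp := @measurable_spectral R d.
have wE n x : gn n (spectral x) = g (spectral x) -> weight alpha (gn n) x = weight alpha g x.
  by rewrite /weight => ->.
have w_nd x : nondecreasing_seq (fun n => weight alpha (gn n) x).
  move=> m n mn; rewrite /weight; case: ifP => // _.
  by rewrite lee_wpmul2r ?lee_fin ?powR_ge0// gn_nd.
transitivity (\int[mu]_x g (spectral x)).
  apply: (eq_integral_tail tail_mu) => //.
  - exact: (measurableT_comp mh).
  - exact: (measurableT_comp mg).
  - by move=> x xl0 _; rewrite /g mem_set//; exact: spectral_l0.
transitivity (\int[mu]_x (density alpha x * weight_sum alpha g x)); last first.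
  apply: (eq_integral_tail tail_mu) => //.
  - by apply: emeasurable_funM => //; exact: mws.
  - by apply: emeasurable_funM => //; exact: mws.
  - by move=> x; rewrite mule_ge0// ws0.
  - by move=> x; rewrite mule_ge0// ws0.
  - move=> x xl0 _; congr (_ * _); apply: eq_esum => k _.
    rewrite /weight /g [spectral _ \in _]mem_set//.
    by apply: spectral_l0; exact: l0_shift.
have lim1 : \int[mu]_x gn n (spectral x) @[n --> \oo] --> \int[mu]_x g (spectral x).
  rewrite (_ : (fun x => g (spectral x)) = fun x => limn (fun n => gn n (spectral x))).
    apply: cvg_monotone_convergence => //.
    by move=> n; exact: (measurableT_comp (mgn n)).
  by apply/funext => x; apply/esym/cvg_lim => //; apply: cvg_near_cst; exact: gnE.
pose Wn n x := density alpha x * weight_sum alpha (gn n) x.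
have lim2 : \int[mu]_x Wn n x @[n --> \oo] --> \int[mu]_x (density alpha x * weight_sum alpha g x).
  rewrite (_ : (fun x => density alpha x * _) = fun x => limn (Wn ^~ x)).
    apply: cvg_monotone_convergence => //.
    - by move=> n; apply: emeasurable_funM => //; exact: mws.
    - by move=> n x _; rewrite mule_ge0// ws0.
    - move=> x _ m n mn; rewrite lee_wpmul2l//; apply: le_esum => k _; exact: w_nd.
  apply/funext => x; apply/esym/cvg_lim => //.
  apply: cvgeZl => //; apply: esum_cvg.
  - by move=> n k; exact: weight_ge0.
  - by move=> k; exact: w_nd.
  - move=> k; apply: cvg_near_cst.
    by apply: filterS (gnE (spectral (shift_field k x))) => n; exact: wE.
have eqn n : \int[mu]_x gn n (spectral x) = \int[mu]_x Wn n x.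
  apply: (spectral_formula_ball tail_mu (mgn n) (gn0 n) (s := n.+1%:R)).
    by rewrite ler1n.
  by move=> x nx; rewrite /gn memNset.
by move: lim1; under eq_cvg do rewrite eqn; move=> /(cvg_unique _ lim2) ->.
Unshelve. all: by end_near. Qed.

End spectral_formula.

(** * Anchored processes and their representatives *)
Section anchoring.
Context {R : realType} {d : nat}.
Local Notation Z := 'rV[int]_d.
Local Notation F := (rfield R d).
Implicit Types (x : F) (k : Z).
Variables (mu : probability F R) (alpha : R).
Hypothesis tail_mu : tail_law alpha mu.
Local Open Scope ereal_scope.

Variable A : F -> Z.
Hypothesis anchA : anchoring A.

Definition anchored_at0 : set F := E0 `&` A @^-1` [set 0%R].

Lemma measurable_anchored_at0 : measurable anchored_at0.
Proof. by case: anchA => mA _ _; exact: mA. Qed.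

(** Exchange formula with s = 1: among the exceedances k of a field, exactly one,
namely its anchor, moves the anchor to the origin when it is made the new
origin. *)
Lemma anchored_integral (G : F -> \bar R) :
  measurable_fun setT G -> (forall x, 0 <= G x) ->
  (forall x k, l0 x -> G (shift_field k x) = G x) ->
  \int[mu]_x (inv_count x * G x) = \int[mu]_(x in anchored_at0) G x.
Proof.
move=> mG G0 Gshift; have [_ Aex Ashift] := anchA.
have mi := @measurable_inv_count R d; have i0 := @inv_count_ge0 R d.
pose g x : \bar R := if x \in anchored_at0 then inv_count x * G x else 0.
have mg : measurable_fun setT g.
  by apply: measurable_if_in; [exact: measurable_anchored_at0|exact: emeasurable_funM].
have g0 x : 0 <= g x by rewrite /g; case: ifP => // _; rewrite mule_ge0.
have := exchange_formula tail_mu (lexx 1%R) mg g0.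
rewrite one_powR mul1e => H.
transitivity (\int[mu]_x (\esum_(k in [set: Z]) (above 1^-1 k x * g (shift_field k x)))).
  apply: (eq_integral_tail tail_mu).
  - exact: emeasurable_funM.
  - apply: measurable_esum => [k x|k]; first by rewrite mule_ge0// above_ge0.
    apply: emeasurable_funM; first exact: measurable_above.
    by apply: (measurableT_comp mg); exact: measurable_shift.
  - by move=> x; rewrite mule_ge0.
  - by move=> x; apply: esum_ge0 => k _; rewrite mule_ge0// above_ge0.
  move=> x xl0 x0.
  have xE0 : E0 x by split => //; exact: finite_exceed_l0.
  rewrite -[LHS](esum_pick (A x) (a := fun=> inv_count x * G x)); last first.
    by move=> _; rewrite mule_ge0.
  apply: eq_esum => k _; rewrite invr1 aboveE.
  have xA := Aex _ xE0.
  have [xk|nxk] := boolP (1 < `|x k|)%R; last first.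
    rewrite mul0e; case: eqP => // kA; move: nxk; rewrite kA.
    by move/negP; case; exact: xA.
  rewrite mul1e /g inv_count_shift Gshift//.
  have kE0 : E0 (shift_field k x).
    split; first by rewrite /shift_field add0r.
    by apply: finite_exceed_l0; exact: l0_shift.
  case: eqP => [kA|kA].
    rewrite mem_set//; split => //=; apply: (addIr k).
    by rewrite Ashift// add0r kA.
  rewrite memNset// => -[_ /= A0]; apply: kA.
  by rewrite -(Ashift _ xE0 k xk) A0 add0r.
rewrite H [RHS]integral_mkcond; apply: eq_integral => x _.
rewrite fdiv1 /g patchE; case: ifPn; last by rewrite mule0.
rewrite inE => -[[x0 fx] _].
by rewrite muleA (count_aboveK fx x0) mul1e.
Qed.

End anchoring.

Section truncation.
Context {R : realType} {dT : measure_display} {T : measurableType dT}.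
Local Open Scope ereal_scope.

(** Representatives are compared on real-valued functions, whereas the sums over
the lattice may be infinite; truncation reduces these to the former. *)
Definition trunc (n : nat) (y : \bar R) : \bar R := mine y n%:R%:E.

Lemma trunc_ge0 n y : 0 <= y -> 0 <= trunc n y.
Proof. by move=> y0; rewrite /trunc le_min y0 lee_fin ler0n. Qed.

Lemma trunc_fin n y : 0 <= y -> trunc n y \is a fin_num.
Proof.
move=> y0; rewrite ge0_fin_numE ?trunc_ge0// /trunc gt_min.
by rewrite [(_ < +oo) in X in _ || X]ltry orbT.
Qed.

Lemma trunc_nd y : nondecreasing_seq (trunc^~ y).
Proof.
move=> m n mn; rewrite /trunc le_min !ge_min lexx /= .
by rewrite lee_fin ler_nat mn orbT.
Qed.

Lemma trunc_cvg y : 0 <= y -> trunc n y @[n --> \oo] --> y.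
Proof.
case: y => [r r0|_|//].
  apply: cvg_near_cst; near=> n; apply/min_idPl; rewrite lee_fin.
  by near: n; exact: nbhs_infty_ger.
rewrite (_ : (fun n => _) = fun n => n%:R%:E); last first.
  by apply/funext => n; apply/min_idPr; rewrite leey.
exact/cvgeryP/cvgr_idn.
Unshelve. all: by end_near. Qed.

Lemma measurable_trunc n (f : T -> \bar R) : measurable_fun setT f ->
  measurable_fun setT (fun w => trunc n (f w)).
Proof. by move=> mf; apply: measurable_mine. Qed.

Lemma integral_trunc_cvg (m : {measure set T -> \bar R}) (f : T -> \bar R) :
  measurable_fun setT f -> (forall w, 0 <= f w) ->
  \int[m]_w trunc n (f w) @[n --> \oo] --> \int[m]_w f w.
Proof.
move=> mf f0; rewrite (_ : (fun w => f w) = fun w => limn (fun n => trunc n (f w))).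
  apply: cvg_monotone_convergence => //.
  - by move=> n; exact: measurable_trunc.
  - by move=> n w _; exact: trunc_ge0.
  - by move=> w _; exact: trunc_nd.
by apply/funext => w; apply/esym/cvg_lim => //; exact: trunc_cvg.
Qed.

End truncation.

Section representatives.
Context {R : realType} {d : nat}.
Local Notation Z := 'rV[int]_d.
Local Notation F := (rfield R d).
Local Open Scope ereal_scope.

(** Only finitely many coordinates exceed 1, so the supremum is a genuine one and
it is larger than 1; hence dividing by it can be undone. *)
Lemma normalize_l0 (x : F) : E0 x -> l0 (normalize x) <-> l0 x.
Proof.
move=> [x0 fx]; split; last exact: l0_fdiv.
have ub : has_ubound [set `|x i|%R | i in [set: Z]].
  have /finite_fsetP[X XE] := fx.
  exists (1 + \sum_(i <- enum_fset X) `|x i|)%R => _ [i _ <-].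
  have [xi|xi] := leP `|x i|%R 1%R.
    by rewrite (le_trans xi)// lerDl sumr_ge0.
  have iX : i \in enum_fset X by have : [set` X] i by rewrite -XE.
  rewrite (big_rem i)//= addrCA lerDl addr_ge0// sumr_ge0//.
have sup_gt0 : (0 < supnorm x)%R.
  apply: lt_le_trans (lt_trans ltr01 x0) _.
  by apply: ub_le_sup => //; exists 0%R.
move=> /(l0_fdiv (supnorm x)^-1%R); rewrite /normalize fdivfdiv divff ?gt_eqF//.
by rewrite fdiv1.
Qed.

Definition on_sphere (f : F -> \bar R) (x : F) : \bar R :=
  if x \in l0 then f (fdiv x (norm_l0 x)) else 0.

Lemma measurable_on_sphere f : measurable_fun setT f ->
  measurable_fun setT (on_sphere f).
Proof.
move=> mf; apply: measurable_if_in; first exact: measurable_l0.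
apply: (measurableT_comp mf); apply: measurable_fdiv => //.
  exact: norm_l0_ge0.
exact: measurable_norm_l0.
Qed.

Lemma on_sphere_ge0 f x : (forall x, 0 <= f x) -> 0 <= on_sphere f x.
Proof. by rewrite /on_sphere; case: ifP. Qed.

Lemma on_sphere_shift f : (forall x k, l0 x -> f (shift_field k x) = f x) ->
  forall x k, l0 x -> on_sphere f (shift_field k x) = on_sphere f x.
Proof.
move=> fs x k xl0; have xkl0 := l0_shift k xl0.
rewrite /on_sphere !mem_set// !norm_l0E// supnorm_shift -shift_fdiv fs//.
exact: l0_fdiv.
Qed.

Variables (dT : measure_display) (T : measurableType dT) (P : probability T R)
  (Y : {RV P >-> F}) (alpha : R).
Hypothesis tailY : tail_law alpha (distribution P Y).
Variables (dQ : measure_display) (TQ : measurableType dQ) (PQ : probability TQ R)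
  (Q : {RV PQ >-> F}).
Hypothesis repQ : anchored_spectral_representative Y Q.

(** The law of the anchored process is [mu] conditioned on the anchor being the
origin, and [anchored_integral] computes both the integral and the
normalization; the anchoring function disappears. *)
Lemma representative_integral (f : F -> \bar R) :
  measurable_fun setT f -> (forall x, 0 <= f x) ->
  (forall x k, l0 x -> f (shift_field k x) = f x) ->
  (\int[distribution P Y]_x inv_count x) * \int[PQ]_w f (Q w) =
  \int[distribution P Y]_x (inv_count x * on_sphere f x).
Proof.
move=> mf f0 fshift; set mu := distribution P Y.
have [Ql0 [A [dZ [TZ [PZ [V [anchA [VE0 VA] repV]]]]]]] := repQ.
have mV : measurable_fun setT V by exact: measurable_funPT.
have mQ : measurable_fun setT Q by exact: measurable_funPT.
have mo := measurable_on_sphere mf.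
have o0 x : 0 <= on_sphere f x by exact: on_sphere_ge0.
have eqQV : \int[PQ]_w f (Q w) = \int[PZ]_w on_sphere f (V w).
  have eqn n : \int[PQ]_w trunc n (f (Q w)) = \int[PZ]_w trunc n (on_sphere f (V w)).
    pose fn x := fine (trunc n (f x)).
    have fnK x : (fn x)%:E = trunc n (f x) by rewrite fineK// trunc_fin.
    have : expect_l0 PQ Q fn = expect_l0 PZ (fun w => normalize (V w)) fn.
      apply: repV; last by move=> x k xl0; rewrite /fn fshift.
      split; last by move=> x _; rewrite /fn fine_ge0// trunc_ge0.
      apply: measurable_funTS; apply: measurableT_comp => //.
      exact: measurable_trunc.
    rewrite /expect_l0 (_ : Q @^-1` l0 = setT); last first.
      by apply/seteqP; split => // w _; exact: Ql0.
    under eq_integral do rewrite fnK.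
    move=> ->; rewrite integral_mkcond; apply: eq_integral => w _.
    have nl0 := normalize_l0 (VE0 w).
    rewrite patchE /on_sphere; have [Vl0|nVl0] := pselect (l0 (V w)).
      rewrite (mem_set Vl0) (mem_set (A := (fun w => normalize (V w)) @^-1` l0)
        (nl0.2 Vl0)) norm_l0E//; exact: fnK.
    rewrite (memNset nVl0) (memNset (A := (fun w => normalize (V w)) @^-1` l0)
      (fun h => nVl0 (nl0.1 h))).
    by rewrite /trunc; apply/esym/min_idPl; rewrite lee_fin.
  have c1 := @integral_trunc_cvg _ _ _ PQ _ (measurableT_comp mf mQ) (fun w => f0 (Q w)).
  have c2 := @integral_trunc_cvg _ _ _ PZ _ (measurableT_comp mo mV) (fun w => o0 (V w)).
  move: c2; under eq_cvg do rewrite -eqn.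
  by move=> /(cvg_unique _ c1) ->.
have mD := measurable_anchored_at0 anchA.
set D := anchored_at0 A in mD *.
have VA' (B : set F) : measurable B -> PZ (V @^-1` B) = mu (B `&` D) / mu D.
  move=> mB; have := VA B mB; rewrite /mu /distribution /= /pushforward.
  rewrite (_ : [set w | [/\ B (Y w), E0 (Y w) & A (Y w) = 0%R]] = Y @^-1` (B `&` D))//.
  by apply/seteqP; split=> w /=; [move=> [? ? ?]|move=> [? [? ?]]].
have p_fin : mu D \is a fin_num by exact: fin_num_measure.
(* the law of the anchored process would have total mass 0 / 0 = 0 *)
have p0 : mu D != 0.
  apply/eqP => D0; have := VA' setT measurableT.
  rewrite preimage_setT setTI D0 mul0e probability_setT => /eqP.
  by rewrite onee_eq0.
pose p : {nonneg R} := NngNum (fine_ge0 (measure_ge0 mu D)).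
have pE : (p%:num)%:E = mu D by rewrite fineK.
have -> : \int[mu]_x inv_count x = mu D.
  transitivity (\int[mu]_x (inv_count x * (cst 1 x : \bar R))).
    by apply: eq_integral => x _; rewrite mule1.
  by rewrite (anchored_integral tailY anchA)// integral_cst// mul1e.
rewrite (anchored_integral tailY anchA)//; last exact: on_sphere_shift.
rewrite eqQV -pE.
transitivity ((p%:num)%:E * \int[pushforward PZ V]_x on_sphere f x).
  by rewrite (ge0_integral_pushforward mV)// preimage_setT.
rewrite -ge0_integral_mscale// -(integral_mrestr mu mD)//.
apply: eq_measure_integral => B mB _.
change ((p%:num)%:E * PZ (V @^-1` B) = mu (B `&` D)).
rewrite VA'// pE muleC -muleA mulVe// mule1//.
Qed.

End representatives.

(** * The two formulas *)
Section tail_process_law.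
Context {R : realType} {d : nat}.
Local Notation F := (rfield R d).
Local Open Scope ereal_scope.

(** Since Y_0 is nonzero, Y vanishes at infinity if and only if its spectral field
does. *)
Lemma tail_process_law
    (dX : measure_display) (TX : measurableType dX) (PX : probability TX R)
    (X : {RV PX >-> F})
    (dT : measure_display) (T : measurableType dT) (P : probability T R)
    (Y : {RV P >-> F}) (alpha : R) :
  tail_process_of X Y -> tail_index Y alpha ->
  P [set w | l0 (spectral (Y w))] = 1 -> tail_law alpha (distribution P Y).
Proof.
move=> hY ha hl; have [a0 _] := ha.
have mY : measurable_fun setT Y by exact: measurable_funPT.
split => //; first exact: law_exceed0 hY.
  have mS : measurable (Y @^-1` (@spectral R d @^-1` l0)).
    rewrite -comp_preimage -[X in measurable X]setTI.
    apply: (measurableT_comp measurable_spectral mY) => //; exact: measurable_l0.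
  have mE : measurable (Y @^-1` [set x : F | (1 < `|x 0%R|)%R]).
    by rewrite -[X in measurable X]setTI; apply: mY => //; exact: measurable_exceed.
  have E1 : P (Y @^-1` [set x : F | (1 < `|x 0%R|)%R]) = 1 by exact: law_exceed0 hY.
  have := probability_setI1 mS mE E1; rewrite [X in _ = X]hl => SE.
  apply/eqP; rewrite eq_le probability_le1/=; last exact: measurable_l0.
  apply: (@le_trans _ _ (P (Y @^-1` (@spectral R d @^-1` l0) `&`
    Y @^-1` [set x : F | (1 < `|x 0%R|)%R]))); first by rewrite SE.
  apply: le_measure; rewrite ?inE.
  - exact: measurableI.
  - by rewrite -[X in measurable X]setTI; apply: mY => //; exact: measurable_l0.
  move=> w [/= /(l0_fdiv (`|Y w 0%R|)^-1%R) + Y0].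
  by rewrite fdivfdiv divff ?fdiv1// gt_eqF// (lt_trans _ Y0).
by move=> s k B s1 mB; exact: (change_of_origin_set hY ha).
Qed.

End tail_process_law.

Section formulas.
Context {R : realType} {d : nat}.
Local Notation Z := 'rV[int]_d.
Local Notation F := (rfield R d).
Local Open Scope ereal_scope.
Implicit Types (x : F) (k : Z).

Lemma weight_fdiv alpha (f : F -> \bar R) x (c : R) : (0 < c)%R ->
  weight alpha f (fdiv x c) = (c `^ (- alpha))%:E * weight alpha f x.
Proof.
move=> c0; rewrite /weight spectral_fdiv// {1}/fdiv mulf_eq0 invr_eq0 (gt_eqF c0) orbF.
case: ifP => _; first by rewrite mule0.
rewrite muleCA; congr (_ * _); rewrite -EFinM; congr EFin.
by rewrite /fdiv normrM normfV (gtr0_norm c0) powR_div// mulrC.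
Qed.

Lemma weight_sum_shift alpha f x k :
  weight_sum alpha f (shift_field k x) = weight_sum alpha f x.
Proof.
rewrite -[RHS](esum_translate k); apply: eq_esum => i _.
by rewrite shift_fieldD.
Qed.

Lemma weight_sum_fdiv alpha (f : F -> \bar R) x (c : R) :
  (forall y, 0 <= f y) -> (0 < c)%R ->
  weight_sum alpha f (fdiv x c) = (c `^ (- alpha))%:E * weight_sum alpha f x.
Proof.
move=> f0 c0; rewrite /weight_sum -esumMl ?lee_fin ?powR_ge0//; last first.
  by move=> k; exact: weight_ge0.
by apply: eq_esum => k _; rewrite shift_fdiv weight_fdiv.
Qed.

Definition power_sum (alpha : R) x : \bar R :=
  \esum_(k in [set: Z]) (`|x k| `^ alpha)%:E.

(** Terms with x_k = 0 vanish on both sides because [alpha] is positive. *)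
Lemma power_sumE alpha x : (0 < alpha)%R ->
  power_sum alpha x = weight_sum alpha (cst 1) x.
Proof.
move=> a0; apply: eq_esum => k _; rewrite /weight /shift_field add0r mul1e.
by case: eqP => // ->; rewrite normr0 powR0// gt_eqF.
Qed.

Lemma power_sum_ge alpha x k : (`|x k| `^ alpha)%:E <= power_sum alpha x.
Proof.
apply: esum_ge; exists [set k]; first by split.
by rewrite fsbig_set1.
Qed.

Lemma power_sum_ge0 alpha x : 0 <= power_sum alpha x.
Proof. by apply: esum_ge0 => k _; rewrite lee_fin powR_ge0. Qed.

Lemma measurable_power_sum alpha :
  measurable_fun setT (power_sum alpha : F -> \bar R).
Proof.
apply: measurable_esum => [k x|k]; first by rewrite lee_fin powR_ge0.
apply/measurable_EFinP.
exact: (measurableT_comp (measurable_powR alpha) (measurable_abs_coord k)).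
Qed.

Lemma power_sum_fdiv alpha x (c : R) : (0 < alpha)%R -> (0 < c)%R ->
  power_sum alpha (fdiv x c) = (c `^ (- alpha))%:E * power_sum alpha x.
Proof. by move=> a0 c0; rewrite !power_sumE// weight_sum_fdiv. Qed.

Lemma power_sum_shift alpha x k : (0 < alpha)%R ->
  power_sum alpha (shift_field k x) = power_sum alpha x.
Proof. by move=> a0; rewrite !power_sumE// weight_sum_shift. Qed.

Variables (dT : measure_display) (T : measurableType dT) (P : probability T R)
  (Y : {RV P >-> F}) (alpha : R).
Hypothesis tailY : tail_law alpha (distribution P Y).
Let mu := distribution P Y.
Let alpha_gt0 : (0 < alpha)%R. Proof. by case: tailY. Qed.

Lemma integral_law (f : F -> \bar R) : measurable_fun setT f ->
  (forall x, 0 <= f x) -> \int[P]_w f (Y w) = \int[mu]_x f x.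
Proof. by move=> mf f0; rewrite ge0_integral_distribution. Qed.

(** The two inverses of the count differ only for fields without exceedances,
which have probability 0. *)
Lemma varthetaE : vartheta Y = \int[mu]_x inv_count x.
Proof.
pose S : set F := @count_above R d @^-1` [set 0].
have mS : measurable S.
  rewrite -[S]setTI; apply: measurable_count_above => //; exact: emeasurable_set1.
(* extended inversion, as opposed to inv_count, sends the count 0 to +oo *)
pose u x : \bar R := (if x \in S then +oo else 0) + inv_count x.
have mu_ : measurable_fun setT u.
  by apply: emeasurable_funD; [exact: measurable_if_in|exact: measurable_inv_count].
have u0 x : 0 <= u x by rewrite adde_ge0 ?inv_count_ge0//; case: ifP.
transitivity (\int[P]_w u (Y w)).
  apply: eq_integral => w _; rewrite counting_exceed /u /inv_count.
  have := count_above_ge0 (Y w).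
  have [nY0 _|nY0] := eqVneq (count_above (Y w)) 0.
    by rewrite mem_set// nY0 inve0 /= invr0 adde0.
  rewrite memNset ?add0e; last by move=> /= /eqP; apply/negP.
  case: (count_above (Y w)) nY0 => [r|//|//] /=; last by rewrite invey invr0.
  by rewrite eqe => r0 _; rewrite inver (negbTE r0).
rewrite integral_law//; apply: (eq_integral_tail tailY) => //.
- exact: measurable_inv_count.
- exact: inv_count_ge0.
move=> x xl0 x0; rewrite /u memNset ?add0e// => /= n0.
by have := count_above_ge1 x0; rewrite n0 lee_fin ler10.
Qed.

Lemma vartheta_fin : vartheta Y \is a fin_num.
Proof.
rewrite varthetaE ge0_fin_numE; last by apply: integral_ge0 => x _; exact: inv_count_ge0.
apply: (@le_lt_trans _ _ (\int[mu]_x cst 1 x)); last first.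
  by rewrite integral_cst// mul1e (le_lt_trans (probability_le1 mu measurableT))// ltry.
apply: ge0_le_integral => //.
- by move=> x _; exact: inv_count_ge0.
- exact: measurable_inv_count.
move=> x _; rewrite lee_fin; have [ex|nex] := pselect (exists k, (1 < `|x k|)%R).
  have [k /count_above_ge1] := ex; case: (count_above x) => [r|_|//]; last by rewrite /= invr0.
  by rewrite lee_fin => r1; rewrite invf_le1// (lt_le_trans ltr01).
rewrite /count_above esum1 ?invr0// => k _; rewrite aboveE ifF//.
by apply/negP => xk; apply: nex; exists k.
Qed.

(** By the spectral formula with h = 1, this product has integral 1. *)
Lemma finite_power_sum_ae :
  {ae mu, forall x, density alpha x * power_sum alpha x \is a fin_num}.
Proof.
have : mu.-integrable setT (fun x => density alpha x * weight_sum alpha (cst 1) x).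
  apply/integrableP; split.
    apply: emeasurable_funM; first exact: measurable_density.
    exact: measurable_weight_sum.
  rewrite (eq_integral (fun x => density alpha x * weight_sum alpha (cst 1) x)); last first.
    by move=> x _; rewrite gee0_abs// mule_ge0 ?density_ge0// weight_sum_ge0.
  rewrite -(spectral_formula tailY)// integral_cst// mul1e.
  by rewrite (le_lt_trans (probability_le1 mu measurableT))// ltry.
move=> /(integrable_ae measurableT); apply: filterS => x /(_ Logic.I).
by rewrite power_sumE.
Qed.

Variables (dQ : measure_display) (TQ : measurableType dQ) (PQ : probability TQ R)
  (Q : {RV PQ >-> F}).
Hypothesis repQ : anchored_spectral_representative Y Q.

(** The sum of weights is homogeneous of degree [alpha], so its value on normalized
fields produces the factor by which [density] differs from [inv_count]. *)
Lemma first_formula (f : F -> \bar R) :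
  measurable_fun setT f -> (forall x, 0 <= f x) ->
  \int[mu]_x f (spectral x) = vartheta Y * \int[PQ]_w weight_sum alpha f (Q w).
Proof.
move=> mf f0; have mw := measurable_weight_sum alpha mf f0.
have w0 := weight_sum_ge0 alpha f0.
rewrite varthetaE (representative_integral tailY repQ mw w0); last first.
  by move=> x k _; exact: weight_sum_shift.
rewrite (spectral_formula tailY)//; apply: (eq_integral_tail tailY).
- by apply: emeasurable_funM => //; exact: measurable_density.
- apply: emeasurable_funM; first exact: measurable_inv_count.
  exact: measurable_on_sphere.
- by move=> x; rewrite mule_ge0 ?density_ge0// w0.
- by move=> x; rewrite mule_ge0 ?inv_count_ge0// on_sphere_ge0.
move=> x xl0 x0; rewrite /on_sphere mem_set//.
have M0 : (0 < norm_l0 x)%R.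
  by rewrite norm_l0E// (lt_le_trans _ (supnorm_ge 0%R xl0))// (lt_trans _ x0).
rewrite weight_sum_fdiv//.
by rewrite /density muleA [X in X * _ = _]muleC.
Qed.

(** For [f] equal to 1 the first formula exhibits 1 as a multiple of vartheta. *)
Lemma vartheta_neq0 : vartheta Y != 0.
Proof.
apply/eqP => t0; have := @first_formula (cst 1) (measurable_cst _) (fun=> lee01).
rewrite t0 mul0e integral_cst// mul1e => h.
by have /eqP := etrans (esym (probability_setT mu)) h; rewrite onee_eq0.
Qed.

Variable le : rel Z.
Hypothesis ordle : group_order le.

(** The last factor is the real inverse of the power sum, equal to 0 if the sum is
infinite. *)
Definition second_integrand (f : F -> \bar R) x : \bar R :=
  f (fdiv (shift_first_max le x) (norm_l0 x)) *
  ((norm_l0 x `^ alpha)%:E * ((fine (power_sum alpha x))^-1)%:E).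

Lemma second_integrand_ge0 f x : (forall y, 0 <= f y) -> 0 <= second_integrand f x.
Proof.
move=> f0; rewrite !mule_ge0// lee_fin ?powR_ge0// invr_ge0 fine_ge0//.
exact: power_sum_ge0.
Qed.

Lemma measurable_second_integrand f : measurable_fun setT f ->
  measurable_fun setT (second_integrand f).
Proof.
move=> mf; apply: emeasurable_funM.
  apply: (measurableT_comp mf); apply: measurable_fdiv; first exact: norm_l0_ge0.
    exact: measurable_shift_first_max.
  exact: measurable_norm_l0.
apply: emeasurable_funM; apply/measurable_EFinP.
  exact: (measurableT_comp (measurable_powR alpha) measurable_norm_l0).
apply: measurable_funV_ge0 => [x _|]; first exact/fine_ge0/power_sum_ge0.
by apply: measurableT_comp => //; exact: measurable_power_sum.
Qed.

(** [second_integrand] is invariant under shifts and scalings, so it factors out of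
the sum of its weights and leaves the power sum, which cancels. *)
Lemma second_formula (f : F -> \bar R) :
  measurable_fun setT f -> (forall x, 0 <= f x) ->
  vartheta Y * \int[PQ]_w f (shift_first_max le (Q w)) =
  \int[mu]_x second_integrand f (spectral x).
Proof.
move=> mf f0.
have msf := measurable_shift_first_max (R := R) ordle.
pose fA x := f (shift_first_max le x).
have mfA : measurable_fun setT fA by exact: (measurableT_comp mf msf).
have mg := measurable_second_integrand mf.
have g0 x := second_integrand_ge0 x f0.
have fA0 x : 0 <= fA x by exact: f0.
have fAshift x k : l0 x -> fA (shift_field k x) = fA x.
  by move=> xl0; rewrite /fA shift_first_max_shift.
rewrite varthetaE (representative_integral tailY repQ mfA fA0 fAshift).
rewrite [RHS](spectral_formula tailY mg g0).
apply: (eq_integral_tail_ae tailY finite_power_sum_ae).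
- apply: emeasurable_funM; first exact: measurable_inv_count.
  exact: measurable_on_sphere.
- apply: emeasurable_funM; first exact: measurable_density.
  exact: measurable_weight_sum.
- by move=> x; rewrite mule_ge0 ?inv_count_ge0// on_sphere_ge0// => y; exact: f0.
- by move=> x; rewrite mule_ge0 ?density_ge0// weight_sum_ge0.
move=> x xl0 x0 Sfin.
have M0 : (0 < norm_l0 x)%R.
  by rewrite norm_l0E// (lt_le_trans _ (supnorm_ge 0%R xl0))// (lt_trans _ x0).
have Ma0 : (0 < norm_l0 x `^ alpha)%R by exact: powR_gt0.
have dens_gt0 : 0 < density alpha x.
  rewrite /density -EFinM lte_fin mulr_gt0 ?powR_gt0// invr_gt0 fine_gt0//.
  rewrite (lt_le_trans lte01 (count_above_ge1 x0))/= -ge0_fin_numE ?count_above_ge0//.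
  by apply: count_above_fin; exact: finite_exceed_l0.
have [r r0 Sr] : exists2 r : R, (0 < r)%R & power_sum alpha x = r%:E.
  have Spos : 0 < power_sum alpha x.
    apply: lt_le_trans (power_sum_ge alpha x 0%R).
    by rewrite lte_fin powR_gt0// (lt_trans _ x0).
  move: Sfin Spos; case: (power_sum alpha x) => [r _|+ _|//].
    by rewrite lte_fin => r0; exists r.
  by rewrite gt0_muley.
have spec k : x k != 0%R ->
    second_integrand f (spectral (shift_field k x)) = second_integrand f x.
  move=> xk; have xk0 : (0 < `|x k|)%R by rewrite normr_gt0.
  have xkl0 := l0_shift k xl0.
  rewrite (_ : spectral _ = fdiv (shift_field k x) `|x k|); last first.
    by rewrite /spectral; congr (fdiv _ `|_|); rewrite /shift_field add0r.
  rewrite /second_integrand.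
  rewrite shift_first_max_fdiv// shift_first_max_shift//.
  rewrite [X in fdiv _ X]norm_l0E; last exact: l0_fdiv.
  rewrite (norm_l0E (l0_fdiv _ xkl0)) supnorm_fdiv// supnorm_shift norm_l0E//.
  rewrite fdivfdiv mulrC divfK ?gt_eqF//; congr (_ * _).
  rewrite power_sum_fdiv// power_sum_shift// Sr -!EFinM; congr EFin.
  have q0 : (`|x k| `^ (- alpha) != 0)%R by rewrite gt_eqF// powR_gt0.
  by rewrite /= powR_div ?supnorm_ge0// invfM mulrA (mulfK q0).
rewrite /on_sphere mem_set//.
have -> : weight_sum alpha (second_integrand f) x =
    second_integrand f x * power_sum alpha x.
  rewrite -esumMl//.
  apply: eq_esum => k _; rewrite /weight {1 3}/shift_field add0r.
  case: eqP => [->|/eqP xk]; first by rewrite normr0 powR0 ?mule0// gt_eqF.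
  by rewrite spec.
rewrite /density /second_integrand /fA shift_first_max_fdiv// Sr /=.
rewrite [X in _ = X * _]muleC -muleA; congr (_ * _).
rewrite -muleA muleCA -[LHS]mule1; congr (_ * _).
rewrite -!EFinM; congr EFin; rewrite powRN.
by rewrite mulfVK ?gt_eqF// mulVf ?gt_eqF.
Qed.

End formulas.

Section domain_extension.
Context {R : realType} {d : nat}.
Local Notation F := (rfield R d).
Local Open Scope ereal_scope.

Definition extend_l0 (h : F -> R) (x : F) : \bar R :=
  if x \in l0 then (h x)%:E else 0.

Lemma extend_l0E h x : l0 x -> extend_l0 h x = (h x)%:E.
Proof. by move=> xl0; rewrite /extend_l0 mem_set. Qed.

Lemma measurable_extend_l0 h : nonneg_measurable_l0 h ->
  measurable_fun setT (extend_l0 h).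
Proof.
move=> [mh _]; rewrite (_ : extend_l0 h = (EFin \o h) \_ l0); last first.
  by apply/funext => x; rewrite patchE.
by apply/(measurable_restrictT _ _).1; [exact: measurable_l0|exact/measurable_EFinP].
Qed.

Lemma extend_l0_ge0 h x : nonneg_measurable_l0 h -> 0 <= extend_l0 h x.
Proof.
by move=> [_ h0]; rewrite /extend_l0; case: ifPn => //; rewrite inE lee_fin => /h0.
Qed.

Lemma expect_l0E {dT} {T : measurableType dT} (P : probability T R)
    (V : T -> F) h :
  expect_l0 P V h = \int[P]_w extend_l0 h (V w).
Proof. by rewrite /expect_l0 integral_mkcond; apply: eq_integral => w _; rewrite patchE. Qed.

End domain_extension.

Theorem proposition3p9 (R : realType) (d : nat) (hd : (0 < d)%N)
    (dX : measure_display) (TX : measurableType dX) (PX : probability TX R)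
    (X : {RV PX >-> rfield R d})
    (dT : measure_display) (T : measurableType dT) (P : probability T R)
    (Y : {RV P >-> rfield R d})
    (hY : tail_process_of X Y)
    (alpha : R) (halpha : tail_index Y alpha)
    (Theta : T -> rfield R d) (hTheta : Theta = (fun w => spectral (Y w)))
    (hl0 : P [set w | l0 (Theta w)] = 1%E)
    (dQ : measure_display) (TQ : measurableType dQ) (PQ : probability TQ R)
    (Q : {RV PQ >-> rfield R d})
    (hQ : anchored_spectral_representative Y Q)
    (le : rel 'rV[int]_d) (hle : group_order le)
    (h : rfield R d -> R) (hh : nonneg_measurable_l0 h) :
  (expect_l0 P Theta h =
     vartheta Y *
     \int[PQ]_w \esum_(k in [set: 'rV[int]_d])
       (if Q w k == 0%R then 0
        else (h (fdiv (shift_field k (Q w)) `|Q w k|) * `|Q w k| `^ alpha)%:E))%E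
  /\
  (expect_l0 PQ (fun w => shift_first_max le (Q w)) h =
     (vartheta Y)^-1 *
     \int[P]_(w in Theta @^-1` l0)
       ((h (fdiv (shift_first_max le (Theta w)) (supnorm (Theta w))))%:E *
        ((supnorm (Theta w) `^ alpha)%:E /
         \esum_(k in [set: 'rV[int]_d]) (`|Theta w k| `^ alpha)%:E)))%E.
Proof.
have tailY : tail_law alpha (distribution P Y).
  by apply: (tail_process_law hY halpha); rewrite hTheta in hl0.
have [alpha0 _ _ _] := tailY.
set f := extend_l0 h.
have mf : measurable_fun setT f by exact: measurable_extend_l0.
have f0 x : (0 <= f x)%E by exact: extend_l0_ge0.
have [Ql0 _] := hQ.
have msp := @measurable_spectral R d.
split.
  rewrite expect_l0E hTheta -/f.
  transitivity (\int[distribution P Y]_x f (spectral x))%E.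
    by rewrite -integral_law//; exact: (measurableT_comp mf).
  rewrite (first_formula tailY hQ mf f0); congr (_ * _)%E.
  apply: eq_integral => w _; apply: eq_esum => k _.
  rewrite /weight {1 3}/shift_field add0r; case: eqP => // _.
  rewrite /spectral [shift_field k (Q w) 0]/shift_field add0r /f extend_l0E; last first.
    by apply: l0_fdiv; exact: l0_shift.
  by rewrite EFinM.
have tfin := vartheta_fin tailY.
have tn0 := vartheta_neq0 tailY hQ.
rewrite expect_l0E -/f.
transitivity ((vartheta Y)^-1 *
    (vartheta Y * \int[PQ]_w f (shift_first_max le (Q w))))%E.
  by rewrite muleA mulVe// mul1e.
congr (_ * _)%E; rewrite (second_formula tailY hQ hle mf f0).
have mg := measurable_second_integrand alpha hle mf.
rewrite -(integral_law Y (f := fun x => second_integrand alpha le f (spectral x))); last 2 first.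
- exact: (measurableT_comp mg).
- by move=> x; exact: second_integrand_ge0.
rewrite [RHS]integral_mkcond hTheta; apply: eq_integral => w _; rewrite patchE.
set x := spectral (Y w).
have [xl0|nxl0] := pselect (l0 x); last first.
  rewrite memNset// /second_integrand /norm_l0 memNset// powR0 ?gt_eqF//.
  by rewrite mul0e mule0.
rewrite mem_set// /second_integrand norm_l0E// /f extend_l0E; last first.
  by apply: l0_fdiv; exact: l0_shift.
congr (_ * _)%E; rewrite -/(power_sum alpha x).
(* the real and the extended inverse of the power sum differ only if it is 0, and
   then so is the norm, which it dominates *)
have [k xk] := argmax_ex xl0.
have := power_sum_ge alpha x k; rewrite -(supnormE xk).
have [->|Mneq0] := eqVneq (supnorm x `^ alpha) 0; first by rewrite !mul0e.
have M0 : 0 < supnorm x `^ alpha by rewrite lt0r Mneq0 powR_ge0.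
case: (power_sum alpha x) => [r|_|//]; last by rewrite /= invr0 invey.
by rewrite lee_fin => /(lt_le_trans M0) r0; rewrite inver gt_eqF.
Qed.
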